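(* Let $q$ be an odd prime power. Let $a,b\in\mathbb{F}_q$ satisfy $b\neq 0$, $b\neq\pm1$, and $a\neq\pm b$. Define $$F_{a,b}(x)=x^5+a x^{q+4}+b x^{4q+1}+\frac ab x^{5q}.$$ Then $F_{a,b}$ is a permutation polynomial of $\mathbb{F}_{q^2}$ if and only if one of the following holds. (I) $q\equiv1\pmod4$, $q\not\equiv1\pmod5$, and either $$b^2+2b+5=0\ \text{ and }\ \chi(b)=1,$$ or $$b^2-2b+5=0\ \text{ and }\ \chi(b)=-1.$$ (II) $$(q,b)\in\{(7,2),(7,3),(7,4),(7,5),(19,2),(19,4),(19,5),(19,7),(23,7),(23,16)\}.$$
   Context: $\chi$ denotes the quadratic character of $\mathbb{F}_q$, extended by $\chi(0)=0$ (so $\chi(t)=1$ if $t$ is a nonzero square in $\mathbb{F}_q$ and $\chi(t)=-1$ if $t$ is a nonsquare). A polynomial $f$ over a finite field $k$ is a permutation polynomial of $k$ if $x\mapsto f(x)$ is a bijection of $k$. In (II), $q$ is prime and the integer listed for $b$ denotes its residue class in $\mathbb{F}_q=\mathbb{Z}/q\mathbb{Z}$. *)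

(* Defs.v *)
From HB Require Import structures.
From mathcomp Require Import all_boot all_order all_algebra all_field.

Set Implicit Arguments.
Unset Strict Implicit.
Unset Printing Implicit Defensive.

Import GRing.Theory.
Local Open Scope ring_scope.

Definition chi (F : finFieldType) (t : F) : int :=
  if t == 0 then 0 else if [exists s : F, t == s ^+ 2] then 1 else -1.

Definition permutation_poly (k : finFieldType) (f : {poly k}) : Prop :=
  bijective (horner f).

Definition Fab (F : finFieldType) (q : nat) (a b : F) : {poly F} :=
  'X^5 + a *: 'X^(q + 4) + b *: 'X^(4 * q + 1) + (a / b) *: 'X^(5 * q).

Definition exceptional_pairs : seq (nat * nat) :=
  [:: (7, 2); (7, 3); (7, 4); (7, 5); (19, 2); (19, 4); (19, 5); (19, 7);
      (23, 7); (23, 16)]%N.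

(* Main.v *)
Require Import Defs.
From HB Require Import structures.
From Stdlib Require Import ZArith.
From mathcomp Require Import all_boot all_order all_algebra all_solvable all_field.
From mathcomp Require Import ring zify ssrZ.

Set Implicit Arguments.
Unset Strict Implicit.
Unset Printing Implicit Defensive.

(* The key Z is taken by the scope of int; binary integers get their own. *)
Delimit Scope Z_scope with coqZ.
Import GRing.Theory.
Local Open Scope ring_scope.

(** Write x' for x^q and put Q(x) = x^5 + b x^(4q+1) = x (x^4 + b x'^4).
    With c = a/b the polynomial F_(a,b) is x |-> Q(x) + c Q(x)', and
    w |-> w + c w' is invertible because c^2 <> 1; so F_(a,b) and Q are
    bijections of the quadratic extension together (Fab_perm_quintic).

    For u in the base field Q(ux) = u^5 Q(x), so 5 must not divide q - 1, and
    then Q is bijective as soon as the map induced on y = x'/x,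
      g(y) = y (y^4 + b) / (1 + b y^4),
    is injective on the elements of norm one (norm1_injective_bij).

    Sufficiency of (I).  When b^2 + 2b + 5 = 0, that is b = -1 + 2i, the map g
    is multiplication by the Gaussian integer b of norm 5 in terms of the
    lemniscate sine, and the numerator of g(y) - g(z) splits as (y - z) times
      (y^2 + z^2 + (b+3) yz)^2 + b (y^2 z^2 - 1)^2.
    Divided by (yz)^2 this is U^2 + b d^2 with U fixed and d negated by
    conjugation; as -b is a square of the base field, both vanish, and this
    leaves no y <> z.  The other sign is similar: U^2 + b V^2 with U and V
    fixed by conjugation and -b not a square.

    Necessity.  If Q is bijective then the sum of Q(x)^e over the extension is
    0 for 0 < e < q^2 - 1 (Hermite).  Taking e = al + q be with al + be = q - 1
    makes this a sum of products of two binomial coefficients over a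
    congruence class modulo q + 1 (quintic_power_sum).  In characteristic p
    one has C(q-1-al, j) = (-1)^j C(j+al, al) (natr_bin_compl), so everything
    becomes explicit.

    For q = 1 mod 4 and al = 1 the result is (B-1)(B^2+2B+5) = 0 with
    B = chi(b) b, which is (I) because b <> 1, -1 (quintic_perm_1mod4).

    For q = 3 mod 4, put n = (q+1)/4 and s = (-b)^n, so that s^4 = b^2.  Taking
    al = 4l - 1 gives a polynomial equation for s.  Since n is 1/4 modulo p^2
    (modulo p when q = p) its coefficients depend on l and p only, and are
    reductions of fixed rational numbers if al < p.  The equations for l = 1
    and l = 2 imply N (1+s)(1+s^2) = 0, where the prime factors of the integer
    N are 2, 3, 5, 7, 11, 19, 23, 31 and primes that are 1 modulo 4, while
    (1+s)(1+s^2) <> 0.  Characteristics 11 and 31 are excluded by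
    q <> 1 mod 5.  In characteristics 3, 7, 19 and 23 with q > p, a second
    equation with a larger l, whose coefficients are computed modulo p from
    residues modulo p^2 (Lucas), again has only (1+s)(1+s^2) in common with the
    first, up to a power of s; for q = 27 the second equation is s^26 = 1.
    All these eliminations are Bezout identities between explicit integer
    polynomials.  What remains is q = 7, 19, 23, where the values of Q at all
    u + iv are tabulated (gauss_quintic_table). *)

(** * Power sums over a finite field *)

Section PowerSums.
Variable K : finFieldType.
Implicit Type x : K.

Lemma expf_card_pred x : x != 0 -> x ^+ #|K|.-1 = 1.
Proof.
move=> x0; apply: (mulfI x0).
by rewrite mulr1 -exprS prednK ?expf_card //; apply/card_gt0P; exists x.
Qed.

(** Translation by 1 permutes K, so the sum of all elements is unchanged by it. *)
Lemma natr_card_finField : #|K|%:R = 0 :> K.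
Proof.
have: \sum_(x : K) (x + 1) = \sum_(x : K) x.
  by rewrite [RHS](reindex_inj (addIr 1)).
rewrite big_split /= sumr_const => /eqP.
by rewrite addrC -subr_eq0 addrK => /eqP.
Qed.

Lemma finField_nonroot r : (0 < r < #|K|.-1)%N -> exists2 x : K, x != 0 & x ^+ r != 1.
Proof.
case/andP=> r0 rK; apply/exists_inP; apply: contraLR rK => /exists_inPn H.
rewrite -leqNgt; have -> : #|K|.-1 = size (enum (predC1 (0 : K))).
  by rewrite -cardE cardC1.
apply: max_unity_roots (enum_uniq _) => //.
apply/allP=> x; rewrite mem_enum unity_rootE => /H.
by rewrite negbK.
Qed.

(** If some unit u has u^e <> 1, multiplication by u^e fixes the sum. *)
Lemma sum_expr_finField e : (0 < e)%N ->
  \sum_(x : K) x ^+ e = - (#|K|.-1 %| e)%:R.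
Proof.
move=> e0; have K1 : (1 < #|K|)%N := finNzRing_gt1 K.
have [/dvdnP[t et]|nd] := boolP (#|K|.-1 %| e)%N.
  transitivity (\sum_(x : K | x != 0) (1 : K)).
    rewrite (bigD1 0) //= expr0n gtn_eqF // add0r.
    by apply: eq_bigr => x x0; rewrite et mulnC exprM expf_card_pred ?expr1n.
  rewrite sumr_const cardC1; apply/eqP; rewrite -subr_eq0 opprK -mulrSr.
  by rewrite prednK ?natr_card_finField // ltnW.
have [u u0 ur] : exists2 u : K, u != 0 & u ^+ (e %% #|K|.-1) != 1.
  apply: finField_nonroot; rewrite lt0n ltn_mod nd /=.
  by case: #|K| K1 => [|[]].
have ue : u ^+ e != 1.
  by rewrite (divn_eq e #|K|.-1) exprD mulnC exprM expf_card_pred // expr1n mul1r.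
apply/eqP; rewrite oppr0; have: (u ^+ e - 1) * (\sum_(x : K) x ^+ e) == 0.
  rewrite mulrBl mul1r subr_eq0 [X in _ == X](reindex_inj (mulfI u0)) mulr_sumr.
  by apply/eqP/eq_bigr => x _; rewrite exprMn.
by rewrite mulf_eq0 subr_eq0 (negPf ue).
Qed.

(** The necessary half of Hermite's criterion. *)
Lemma hermite_power_sum (f : K -> K) e : bijective f -> (0 < e < #|K|.-1)%N ->
  \sum_(x : K) f x ^+ e = 0.
Proof.
move=> fbij /andP[e0 eK]; rewrite -(reindex f (P := predT) (F := fun x => x ^+ e)).
  by rewrite sum_expr_finField // gtnNdvd // oppr0.
exact: onW_bij.
Qed.

End PowerSums.

(** * Binomial coefficients in characteristic p *)

Lemma prime_pow_dvd_bin p k j : prime p -> (0 < j < p ^ k)%N -> (p %| 'C(p ^ k, j))%N.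
Proof.
move=> pp /andP[j0 jk]; case: (boolP (p %| _)%N) => // npC.
have cop : coprime (p ^ k) 'C(p ^ k, j) by rewrite coprimeXl // prime_coprime.
have := mul_bin_diag (p ^ k) j.-1; rewrite !prednK // => E.
have : (p ^ k %| j * 'C(p ^ k, j))%N by rewrite -E dvdn_mulr.
by rewrite Gauss_dvdl // => /(dvdn_leq j0); rewrite leqNgt jk.
Qed.

Section Characteristic.
Variables (K : finFieldType) (p : nat).
Hypothesis pK : p \in [pchar K].

Lemma card_finField_pchar : #|K| = (p ^ logn p #|K|)%N.
Proof. exact: (card_pprimeChar pK). Qed.

Lemma natr_eq0_pchar n : (n%:R == 0 :> K) = (p %| n)%N.
Proof. by rewrite (dvdn_pcharf pK). Qed.

(** Lucas: (1+X)^(p^r t) = (1+X^(p^r))^t contributes nothing in the degrees 1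
    to al; by induction on t this is Vandermonde's convolution. *)
Lemma natr_bin_addM r m t al : (al < p ^ r)%N ->
  'C(m + p ^ r * t, al)%:R = 'C(m, al)%:R :> K.
Proof.
move=> alr; elim: t => [|t IH]; first by rewrite muln0 addn0.
rewrite mulnS addnCA -binomial.Vandermonde natr_sum big_ord_recl bin0 mul1n subn0 IH.
rewrite big1 ?addr0 // => i _; apply/eqP; rewrite natr_eq0_pchar dvdn_mulr //.
rewrite prime_pow_dvd_bin ?(pcharf_prime pK) //=.
by apply: leq_ltn_trans alr; rewrite /= /bump /= add1n.
Qed.

Lemma natr_bin_modn r m m' al : (al < p ^ r)%N -> m = m' %[mod p ^ r] ->
  'C(m, al)%:R = 'C(m', al)%:R :> K.
Proof.
move=> alr mm; rewrite (divn_eq m (p ^ r)) (divn_eq m' (p ^ r)) mm.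
by rewrite ![(_ %/ _ * _)%N]mulnC ![(_ * _ + _)%N]addnC !natr_bin_addM.
Qed.

(** For #|K| = q this is C(-1-al, j) = (-1)^j C(j+al, al): the upper entry
    q - 1 - al behaves as -1 - al because C(q, j) = 0 for 0 < j < q. *)
Lemma natr_bin_compl al j : (al < #|K|)%N -> (j < #|K|)%N ->
  'C(#|K|.-1 - al, j)%:R = (-1) ^+ j * 'C(j + al, al)%:R :> K.
Proof.
have pp := pcharf_prime pK; have K1 : (1 < #|K|)%N := finNzRing_gt1 K.
elim: al j => [|al IHal] j alK jK.
  rewrite bin0 mulr1 subn0; elim: j jK => [|j IHj] jK; first by rewrite bin0.
  have : 'C(#|K|, j.+1)%:R = 0 :> K.
    by apply/eqP; rewrite natr_eq0_pchar card_finField_pchar prime_pow_dvd_bin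
      -?card_finField_pchar.
  rewrite -{1}(prednK (ltnW K1)) binS natrD (IHj (ltnW jK)) => /eqP.
  by rewrite addr_eq0 exprS mulN1r => /eqP ->.
elim: j jK => [|j IHj] jK; first by rewrite !bin0 binn mulr1.
have := IHal _ (ltnW alK) jK.
have -> : (#|K|.-1 - al = (#|K|.-1 - al.+1).+1)%N by lia.
rewrite binS natrD (IHj (ltnW jK)) => /(canRL (addrK _)) ->.
rewrite [(j.+1 + al.+1)%N]addnS binS natrD addSnnS !exprS.
ring.
Qed.
End Characteristic.

(** * The quadratic character *)

Section PrimitiveRoot.
Variable K : finFieldType.

Lemma finField_prim_root : exists z : K, #|K|.-1.-primitive_root z.
Proof.
have K1 : (1 < #|K|)%N := finNzRing_gt1 K.
have /hasP[z _ Hz] : has #|K|.-1.-primitive_root (enum (predC1 (0 : K))).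
  apply: has_prim_root; rewrite ?enum_uniq -?cardE ?cardC1 //.
    by case: #|K| K1 => [|[]].
  apply/allP=> x; rewrite mem_enum unity_rootE => x0.
  by rewrite expf_card_pred.
by exists z.
Qed.

Lemma chi_pm1 (t : K) : t != 0 -> chi t = 1 \/ chi t = -1.
Proof. by rewrite /chi => /negPf ->; case: ifP => _; [left|right]. Qed.

(** Euler's criterion. *)
Lemma expf_half_card (t : K) : odd #|K| -> t != 0 -> t ^+ #|K|./2 = (chi t)%:~R.
Proof.
move=> oK t0; rewrite /chi (negPf t0).
have K1 : (1 < #|K|)%N := finNzRing_gt1 K.
have E2 : #|K|.-1 = (#|K|./2 * 2)%N by lia.
have h0 : (0 < #|K|./2)%N by lia.
case: existsP => [[s /eqP ts]|ns].
  rewrite ts -exprM mulnC -E2 expf_card_pred //.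
  by apply: contraNneq t0 => s0; rewrite ts s0 expr0n.
have /eqP : (t ^+ #|K|./2 - 1) * (t ^+ #|K|./2 + 1) = 0.
  by rewrite -subr_sqr_1 -exprM -E2 expf_card_pred // subrr.
rewrite mulf_eq0 subr_eq0 addr_eq0 => /orP[/eqP H|/eqP //].
case: ns; have [z zP] := finField_prim_root.
have [[i _] /= ti] := prim_rootP zP (expf_card_pred t0).
have : (#|K|.-1 %| i * #|K|./2)%N.
  by rewrite (prim_order_dvd zP) exprM -ti H.
rewrite E2 mulnC dvdn_pmul2r // => dv.
case/dvdnP: dv => m im; exists (z ^+ m).
by rewrite ti im exprM.
Qed.
End PrimitiveRoot.

Lemma chi1_sqr (K : finFieldType) (t : K) : chi t = 1 -> exists s, t = s ^+ 2.
Proof. by rewrite /chi; case: ifP => // _; case: existsP => [[s /eqP ts] _|//]; exists s. Qed.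

Lemma chiN1_nonsqr (K : finFieldType) (t s : K) : chi t = -1 -> t != s ^+ 2.
Proof.
rewrite /chi; case: ifP => // _; case: existsP => // ns _.
by apply/eqP=> ts; apply: ns; exists s; rewrite ts.
Qed.

(** * The quintic map on a quadratic extension *)

Definition quintic (R : pzRingType) (q : nat) (b x : R) : R :=
  x ^+ 5 + b * x ^+ (4 * q + 1).

Section QuadraticExtension.
Variables (L : finFieldType) (q : nat).
Hypothesis cardL : #|L| = (q ^ 2)%N.

Lemma card_sqrt_gt1 : (1 < q)%N.
Proof. by have := finNzRing_gt1 L; rewrite cardL; case: q => [|[]]. Qed.

Lemma pnat_card_sqrt : [pchar L].-nat q.
Proof.
have [p pp pL] := finPcharP L.
have pq : p.-nat q.
  have : p.-nat (q ^ 2)%N.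
    by rewrite -cardL (card_finField_pchar pL) pnatX pnat_id ?pp.
  by rewrite pnatX orbF.
by apply: sub_in_pnat pq => r _; rewrite inE => /eqP ->.
Qed.

Lemma exprD_card (x y : L) : (x + y) ^+ q = x ^+ q + y ^+ q.
Proof. exact: exprDn_pchar pnat_card_sqrt. Qed.

Lemma exprN_card (x : L) : (- x) ^+ q = - x ^+ q.
Proof.
apply/eqP; rewrite -addr_eq0 -exprD_card addNr expr0n.
by case: q card_sqrt_gt1.
Qed.

Lemma expr_card2 (x : L) : (x ^+ q) ^+ q = x.
Proof. by rewrite -exprM mulnn -cardL expf_card. Qed.

Lemma quinticE (b x : L) : quintic q b x = x * (x ^+ 4 + b * (x ^+ q) ^+ 4).
Proof. rewrite /quintic exprD mulnC exprM expr1; ring. Qed.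

Lemma quintic_conj (b x : L) : b ^+ q = b ->
  quintic q b x ^+ q = x ^+ q * ((x ^+ q) ^+ 4 + b * x ^+ 4).
Proof.
move=> bq; rewrite quinticE exprMn exprD_card (exprMn _ b) bq !(exprAC _ 4).
by rewrite expr_card2.
Qed.

(** Expand Q^al (Q^q)^be by the binomial theorem and sum over x: a monomial
    x^E survives only when q^2 - 1 divides E, and E = 5 (q^2 - 1) - (q - 1) T
    for the number T = 5 (al + 1) - 4 i + 4 j that is tested here. *)
Lemma quintic_power_sum (b : L) al be :
    bijective (quintic q b) -> b ^+ q = b -> (al + be)%N = q.-1 ->
  \sum_(i < al.+1) \sum_(j < be.+1)
    b ^+ (i + j) *+ ('C(al, i) * 'C(be, j) * (q.+1 %| 5 * al.+1 - 4 * i + 4 * j))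
  = 0.
Proof.
move=> bij bq albe; have q1 := card_sqrt_gt1.
have eL : (0 < al + q * be < #|L|.-1)%N.
  rewrite cardL expnS expn1; apply/andP; split; nia.
have := hermite_power_sum bij eL.
have dvdE (i : 'I_al.+1) (j : 'I_be.+1) :
    (#|L|.-1 %| al + 4 * (al - i) + 4 * j + q * (be + 4 * i + 4 * (be - j)))%N
    = (q.+1 %| 5 * al.+1 - 4 * i + 4 * j)%N.
  have := ltn_ord i; have := ltn_ord j; rewrite !ltnS => jb ia.
  set E := (al + _ + _ + _)%N; set T := (_ - _ + _)%N.
  have ET : (E + q.-1 * T = 5 * #|L|.-1)%N.
    rewrite cardL expnS expn1 /E /T; move: albe q1; case: q => // r /= <- _.
    nia.
  have L1 : #|L|.-1 = (q.-1 * q.+1)%N.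
    by rewrite cardL -mulnn; case: q q1 => // r _; rewrite -subn1; lia.
  have D : (#|L|.-1 %| E + q.-1 * T)%N by rewrite ET dvdn_mull.
  rewrite -[RHS](@dvdn_pmul2l q.-1) -?L1; last by lia.
  by apply/idP/idP => H; [rewrite -(dvdn_addr _ H) | rewrite -(dvdn_addl _ H)].
have expand x : quintic q b x ^+ (al + q * be) =
    \sum_(i < al.+1) \sum_(j < be.+1)
      b ^+ (i + j) *+ ('C(al, i) * 'C(be, j)) *
      x ^+ (al + 4 * (al - i) + 4 * j + q * (be + 4 * i + 4 * (be - j))).
  rewrite exprD exprM quintic_conj // quinticE !(exprMn _ _ (_ + _)).
  rewrite mulrACA !exprDn big_distrlr /= mulr_sumr.
  apply: eq_bigr => i _; rewrite mulr_sumr; apply: eq_bigr => j _.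
  rewrite !(mulrnAl, mulrnAr) -mulrnA; congr (_ *+ _); last exact: mulnC.
  rewrite !(exprMn _ b (_ ^+ 4)) -!exprM.
  transitivity (b ^+ i * b ^+ j * (x ^+ al * x ^+ (q * be) * x ^+ (4 * (al - i))
      * x ^+ (q * (4 * i)) * x ^+ (q * 4 * (be - j)) * x ^+ (4 * j))); first by ring.
  by rewrite -!exprD; congr (_ * x ^+ _); nia.
under eq_bigr => x _ do rewrite expand.
rewrite exchange_big => /eqP; rewrite -oppr_eq0 => /eqP H; rewrite -{}[RHS]H -sumrN /=.
apply: eq_bigr => i _; rewrite exchange_big -sumrN /=; apply: eq_bigr => j _.
rewrite -mulr_sumr sum_expr_finField ?dvdE; last first.
  by have := ltn_ord i; have := ltn_ord j; move: eL => /andP[]; nia.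
by rewrite mulrN opprK mulr_natr -mulrnA.
Qed.

End QuadraticExtension.

(** * Reduction to the case a = 0 *)

Section Subfield.
Variables (F L : finFieldType) (iota : {rmorphism F -> L}) (q : nat).
Hypothesis cardF : #|F| = q.
Hypothesis cardL : #|L| = (q ^ 2)%N.

Lemma iota_expr_card u : iota u ^+ q = iota u.
Proof. by rewrite -rmorphXn -cardF expf_card. Qed.

(** 'X^q - 'X has at most q roots, and the image of F already provides them. *)
Lemma iota_fixed x : x ^+ q = x -> exists u, x = iota u.
Proof.
move=> xq; have q1 := card_sqrt_gt1 cardL.
case: (pickP (fun u => x == iota u)) => [u /eqP ->|nx]; first by exists u.
have H : (size (x :: [seq iota u | u : F]) < size ('X^q - 'X : {poly L})%R)%N.
  apply: max_poly_roots.
  - rewrite -size_poly_eq0 size_polyDl ?size_polyXn //.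
    by rewrite size_polyN size_polyX.
  - rewrite /= rootE !hornerE xq subrr eqxx /=.
    apply/allP=> _ /mapP[u _ ->].
    by rewrite rootE !hornerE iota_expr_card subrr.
  - rewrite /= map_inj_uniq ?enum_uniq ?andbT; last exact: fmorph_inj.
    by apply/mapP=> -[u _ xu]; have := nx u; rewrite xu eqxx.
move: H; rewrite /= size_map -cardE cardF size_polyDl ?size_polyXn ?ltnn //.
by rewrite size_polyN size_polyX.
Qed.

End Subfield.

Section Reduction.
Variables (F L : finFieldType) (iota : {rmorphism F -> L}) (q : nat).
Hypothesis cardF : #|F| = q.
Hypothesis cardL : #|L| = (q ^ 2)%N.
Variables a b : F.
Hypotheses (b0 : b != 0) (ab : a ^+ 2 != b ^+ 2).

Lemma Fab_quintic x : (map_poly iota (Fab q a b)).[x] =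
  quintic q (iota b) x + iota (a / b) * quintic q (iota b) x ^+ q.
Proof.
rewrite /Fab !rmorphD /= !map_polyZ !map_polyXn !hornerE /=.
rewrite (quintic_conj cardL) ?(iota_expr_card iota cardF) // /quintic.
have ea : iota a = iota (a / b) * iota b by rewrite -rmorphM divfK.
by rewrite ea (mulnC 5) exprM (exprD x q 4); ring.
Qed.

Lemma twist_bij : bijective (fun w : L => w + iota (a / b) * w ^+ q).
Proof.
pose c := iota (a / b); have cq : c ^+ q = c by apply: iota_expr_card.
have c2 : 1 - c ^+ 2 != 0.
  rewrite subr_eq0 eq_sym /c -rmorphXn fmorph_eq1 expr_div_n.
  by apply: contraNneq ab => /(canRL (divfK _)) ->; rewrite ?mul1r ?expf_neq0.
apply: injF_bij => w w' /= E; apply/eqP; rewrite -subr_eq0.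
apply/eqP; apply: (mulfI c2); rewrite mulr0.
have := congr1 (fun w => w ^+ q) E.
rewrite /= !(exprD_card cardL) !(exprMn _ c) cq !(expr_card2 cardL) => E'.
transitivity (w + c * w ^+ q - (w' + c * w' ^+ q) - c * (w ^+ q + c * w - (w' ^+ q + c * w'))).
  by ring.
by rewrite E E' !subrr mulr0 subr0.
Qed.

Lemma Fab_perm_quintic :
  permutation_poly (map_poly iota (Fab q a b)) <-> bijective (quintic q (iota b)).
Proof.
split=> H.
  apply: injF_bij => x x' E; apply: (bij_inj H).
  by rewrite !Fab_quintic E.
rewrite /permutation_poly; apply: (eq_bij (bij_comp twist_bij H)) => x /=.
by rewrite Fab_quintic.
Qed.
End Reduction.

(** * Power sums in the base field, and q = 1 mod 4 *)

Lemma sum_pred1_shift (R : nmodType) (g : nat -> R) N s a :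
  \sum_(j < N) g j *+ (j + s == a)%N
  = if (s <= a < N + s)%N then g (a - s)%N else 0.
Proof.
case: ifP => [/andP[sa aN]|H].
  have aN' : (a - s < N)%N by lia.
  rewrite (bigD1 (Ordinal aN')) //= subnK // eqxx mulr1n big1 ?addr0 // => j.
  rewrite -val_eqE /= => /eqP jE.
  by case: eqP => [E|_] //; case: jE; lia.
rewrite big1 // => j _; case: eqP => // E.
by have := ltn_ord j; move: H; lia.
Qed.

Section BasePowerSums.
Variables (F L : finFieldType) (iota : {rmorphism F -> L}) (q : nat).
Hypothesis cardF : #|F| = q.
Hypothesis cardL : #|L| = (q ^ 2)%N.

Variable b : F.
Hypothesis perm : bijective (quintic q (iota b)).

Lemma quintic_power_sum_base al be : (al + be)%N = q.-1 ->
  \sum_(i < al.+1) b ^+ i *+ 'C(al, i) *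
    \sum_(j < be.+1) (b ^+ j *+ 'C(be, j)) *+ (q.+1 %| 5 * al.+1 - 4 * i + 4 * j)
  = 0.
Proof.
move=> albe.
transitivity (\sum_(i < al.+1) \sum_(j < be.+1)
    b ^+ (i + j) *+ ('C(al, i) * 'C(be, j) * (q.+1 %| 5 * al.+1 - 4 * i + 4 * j))).
  apply: eq_bigr => i _; rewrite mulr_sumr; apply: eq_bigr => j _.
  by rewrite exprD mulrnAl -mulrnA mulrnAr -mulrnA; congr (_ *+ _); rewrite mulnC mulnA.
apply: (fmorph_inj iota); rewrite rmorph0.
rewrite -[RHS](quintic_power_sum cardL perm (iota_expr_card iota cardF b) albe) (rmorph_sum iota).
apply: eq_bigr => i _; rewrite (rmorph_sum iota); apply: eq_bigr => j _.
by rewrite rmorphMn rmorphXn.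
Qed.

(** The power sum with al = 1 and be = q - 2.  With q = 4k + 1 the divisibility
    condition leaves j = i + k - 2 and j = i + 3k - 1, and 4k = -1 in F turns
    the four remaining coefficients into -5/4, -3/4, -1/4 and 1/4. *)
Lemma quintic_perm_1mod4 k : q = (4 * k + 1)%N -> b != 0 ->
  (b * b ^+ (2 * k) - 1) * ((b * b ^+ (2 * k)) ^+ 2 + 2%:R * (b * b ^+ (2 * k)) + 5%:R)
  = 0.
Proof.
move=> qk b0; have q1 := card_sqrt_gt1 cardL.
have [p pp pF] := finPcharP F.
have k0 : (0 < k)%N by lia.
have albe : (1 + (q - 2))%N = q.-1 by lia.
have := quintic_power_sum_base albe.
pose g j := (- b) ^+ j * j.+1%:R : F.
have inner (i : 'I_2) :
    \sum_(j < (q - 2).+1) (b ^+ j *+ 'C(q - 2, j)) *+ (q.+1 %| 5 * 2 - 4 * i + 4 * j)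
  = \sum_(j < 4 * k) g j *+ (j + 2 == i + k)%N +
    \sum_(j < 4 * k) g j *+ (j + 1 == i + 3 * k)%N.
  have -> : (q - 2).+1 = (4 * k)%N by lia.
  rewrite -big_split /=; apply: eq_bigr => j _; rewrite -mulrnDr.
  have -> : b ^+ j *+ 'C(q - 2, j) = g j.
    have -> : (q - 2 = #|F|.-1 - 1)%N by lia.
    rewrite -[LHS]mulr_natr (natr_bin_compl pF) ?cardF //; last by have := ltn_ord j; lia.
    by rewrite addn1 bin1 mulrA -exprMn mulrN1.
  congr (_ *+ _).
  have := ltn_ord i; have := ltn_ord j; case: (_ %| _)%N / dvdnP => [[t tE]|H] jk i2.
    have t5 : (t < 5)%N.
      rewrite ltnNge; apply/negP=> t5; have := leq_mul t5 (leqnn q.+1).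
      by rewrite -tE qk; lia.
    have {t5} : [|| t == 0, t == 1, t == 2, t == 3 | t == 4]%N by lia.
    by rewrite qk in tE; case/or4P=> [/eqP t0|/eqP t0|/eqP t0|/orP[/eqP t0|/eqP t0]];
      rewrite t0 in tE; lia.
  case: eqP => E1.
    case: H; exists 1%N; lia.
  case: eqP => E2 //.
  case: H; exists 3%N; lia.
under eq_bigr => i _ do rewrite inner !sum_pred1_shift.
rewrite !big_ord_recl big_ord0 /= /bump /= !add0n !bin0 !binn addr0 expr0 mul1r expr1.
have k4 : 4%:R * k%:R = -1 :> F.
  have := natr_card_finField F.
  by rewrite cardF qk natrD natrM => /eqP; rewrite addr_eq0 => /eqP.
(* For k = 1 the index k - 2 is out of range, but then 5 = q = 0 in F. *)
have low : 4%:R * (- b) ^+ 2 * (if (1 < k < 4 * k + 2)%N then g (k - 2)%N else 0)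
    = - 5%:R * (- b) ^+ k.
  case: ifP => [/andP[k1 _]|k1].
    have e : 4%:R * (k - 2).+1%:R = - 5%:R :> F.
      have -> : (k - 2).+1 = (k - 1)%N by lia.
      by rewrite natrB // mulrBr k4 mulr1 -opprD addrC natr1.
    have ek : (- b) ^+ k = (- b) ^+ (k - 2) * (- b) ^+ 2 by rewrite -exprD subnK.
    by rewrite -e /g ek; move: (k - 2).+1%:R => u; ring.
  have k1' : k = 1%N by lia.
  suff -> : 5%:R = 0 :> F by rewrite mulr0 oppr0 mul0r.
  by have := natr_card_finField F; rewrite cardF qk k1'.
move/(congr1 (fun x => 4%:R * (- b) ^+ 2 * x)).
rewrite mulr0 !mulrDr low mulr1n !ifT; [|lia..].
have -> : (1 + 0 + k - 2 = k - 1)%N by lia.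
have -> : (1 + 0 + 3 * k - 1 = 3 * k)%N by lia.
rewrite /g !subn1 !prednK ?muln_gt0 //.
have ck : (- b) * (- b) ^+ k.-1 = (- b) ^+ k by rewrite -exprS prednK.
have c3k : (- b) ^+ (3 * k) = (- b) ^+ k * b ^+ (2 * k).
  by rewrite (mulnDl 1 2) mul1n exprD [in LHS](exprM _ 2) sqrrN -exprM.
have c3k1 : (- b) * (- b) ^+ (3 * k).-1 = (- b) ^+ (3 * k).
  by rewrite -exprS prednK ?muln_gt0.
have e1 : (b ^+ (2 * k)) ^+ 2 = 1.
  by rewrite -exprM -(expf_card_pred b0) cardF qk; congr (_ ^+ _); lia.
have k43 : 4%:R * (3 * k)%:R = - 3%:R :> F by rewrite natrM mulrCA k4 mulrN1.
have t2 : 4%:R * (- b) ^+ 2 * ((- b) ^+ (3 * k).-1 * (3 * k)%:R)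
    = 3%:R * b * b ^+ (2 * k) * (- b) ^+ k.
  transitivity (4%:R * (3 * k)%:R * (- b) * (- b * (- b) ^+ (3 * k).-1)); first by ring.
  by rewrite k43 c3k1 c3k; ring.
have t3 : 4%:R * (- b) ^+ 2 * (b * ((- b) ^+ k.-1 * k%:R)) = b ^+ 2 * (- b) ^+ k.
  transitivity (4%:R * k%:R * (- b) * b * (- b * (- b) ^+ k.-1)); first by ring.
  by rewrite k4 ck; ring.
have t4 : 4%:R * (- b) ^+ 2 * (b * ((- b) ^+ (3 * k) * (3 * k).+1%:R))
    = b ^+ 3 * b ^+ (2 * k) * (- b) ^+ k.
  transitivity (4%:R * (3 * k).+1%:R * b ^+ 3 * (- b) ^+ (3 * k)).
    by move: (_.+1%:R) => u; ring.
  by rewrite -[(3 * k).+1%:R]natr1 mulrDr k43 c3k; ring.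
rewrite t2 t3 t4 => E; apply: (mulfI (expf_neq0 k (_ : - b != 0))).
  by rewrite oppr_eq0.
rewrite mulr0 -{}[RHS]E; move: e1; move: (b ^+ (2 * k)) ((- b) ^+ k) => e y e1.
have e3 : e ^+ 3 = e by rewrite exprS e1 mulr1.
transitivity (y * (b ^+ 3 * e ^+ 3 + b ^+ 2 * e ^+ 2 + 3%:R * b * e - 5%:R)).
  by ring.
by rewrite e1 e3; ring.
Qed.

End BasePowerSums.

(** * Injectivity on norm-one elements *)

Section Sufficiency.
Variables (F L : finFieldType) (iota : {rmorphism F -> L}) (q : nat).
Hypothesis cardF : #|F| = q.
Hypothesis cardL : #|L| = (q ^ 2)%N.

(** A nontrivial fifth root of unity z of F would give Q(z) = Q(1). *)
Lemma quintic_perm_mod5 b : bijective (quintic q (iota b)) -> ~~ (5 %| q.-1)%N.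
Proof.
move=> bij; apply/negP=> /dvdnP[r qr].
have q1 := card_sqrt_gt1 cardL.
have [u u0 ur] : exists2 u : F, u != 0 & u ^+ r != 1.
  by apply: finField_nonroot; rewrite cardF; lia.
have z5 : (u ^+ r) ^+ 5 = 1 by rewrite -exprM -qr -cardF expf_card_pred.
case/negP: ur; rewrite -(fmorph_eq1 iota); apply/eqP/(bij_inj bij).
rewrite /quintic !expr1n exprD (mulnC 4) exprM (iota_expr_card iota cardF).
by rewrite -exprD -!rmorphXn z5 rmorph1.
Qed.

Lemma fifth_root_trivial (u : F) : u != 0 -> ~~ (5 %| q.-1)%N -> u ^+ 5 = 1 -> u = 1.
Proof.
move=> u0 n5 u5; have := expf_card_pred u0; rewrite cardF.
rewrite (divn_eq q.-1 5) exprD mulnC exprM u5 expr1n mul1r.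
have : (q.-1 %% 5 < 5)%N by rewrite ltn_mod.
move: n5; rewrite /dvdn; case: (_ %% 5)%N => [|[|[|[|[|]]]]] // _ _.
- by move=> u2; move: u5; rewrite (exprD _ 4 1) (exprM _ 2 2) u2 expr1n mul1r.
- move=> u3; move: u5; rewrite (exprD _ 3 2) u3 mul1r => u2.
  by move: u3; rewrite (exprD _ 2 1) u2 mul1r.
- by move=> u4; move: u5; rewrite (exprD _ 4 1) u4 mul1r.
Qed.

Hypothesis q_odd : odd q.

Lemma two_neq0 : 2%:R != 0 :> F.
Proof.
apply/eqP=> two; have := natr_card_finField F; have -> : #|F| = (q./2 * 2).+1 by rewrite cardF; lia.
by rewrite -natr1 natrM two mulr0 add0r => /eqP; rewrite oner_eq0.
Qed.

Lemma twoL_neq0 : 2%:R != 0 :> L.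
Proof. by rewrite -(rmorph_nat iota) fmorph_eq0 two_neq0. Qed.

Lemma self_opp_eq0 (x : L) : x = - x -> x = 0.
Proof.
move=> /eqP; rewrite -addr_eq0 -mulr2n -mulr_natl mulf_eq0 (negPf twoL_neq0).
by move/eqP.
Qed.

Variable b : F.
Hypothesis b2 : b ^+ 2 != 1.

(** Otherwise b y^4 = -1, and taking norms b^2 = 1. *)
Lemma norm1_denom (y : L) : y ^+ q * y = 1 -> 1 + iota b * y ^+ 4 != 0.
Proof.
move=> y1; apply/eqP=> H; case/eqP: b2; apply: (fmorph_inj iota).
have E : iota b * y ^+ 4 = -1 by apply/eqP; rewrite -addr_eq0 addrC H.
have := congr1 (fun x => x ^+ q) E; rewrite (exprN_card cardL) expr1n exprMn.
rewrite (iota_expr_card iota cardF) exprAC => E'.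
rewrite rmorphXn rmorph1.
transitivity ((iota b * y ^+ 4) * (iota b * (y ^+ q) ^+ 4)); last by rewrite E E' mulrNN mulr1.
by rewrite mulrACA -exprMn [y * _]mulrC y1; ring.
Qed.

(** Injectivity on norm-one elements of y |-> y (y^4 + b) / (1 + b y^4), cross
    multiplied. *)
Definition norm1_injective := forall y z : L, y ^+ q * y = 1 -> z ^+ q * z = 1 ->
  y * (y ^+ 4 + iota b) * (1 + iota b * z ^+ 4) = z * (z ^+ 4 + iota b) * (1 + iota b * y ^+ 4) ->
  y = z.

(** With y = x^(q-1) one has Q(x) = x^5 (1 + b y^4) and
    Q(x)^q = x^5 y (y^4 + b).  Hence Q(x) determines y, that is x up to a factor
    u of F, and then u^5 = 1. *)
Lemma norm1_injective_bij : ~~ (5 %| q.-1)%N -> norm1_injective ->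
  bijective (quintic q (iota b)).
Proof.
move=> n5 inj; have q1 := card_sqrt_gt1 cardL.
pose c := iota b; have cq : c ^+ q = c by apply: iota_expr_card.
pose y (x : L) := x ^+ q / x.
have y1 x : x != 0 -> y x ^+ q * y x = 1.
  by move=> x0; rewrite /y expr_div_n (expr_card2 cardL) mulrA divfK ?divff ?expf_neq0.
have Qy x : x != 0 -> quintic q c x = x ^+ 5 * (1 + c * y x ^+ 4).
  move=> x0; rewrite (quinticE q) /y expr_div_n.
  transitivity (x ^+ 5 + x * (c * x ^+ q ^+ 4) * (x ^+ 4 / x ^+ 4)); last by ring.
  by rewrite divff ?expf_neq0 //; ring.
have Qyq x : x != 0 -> quintic q c x ^+ q = x ^+ 5 * (y x * (y x ^+ 4 + c)).
  move=> x0; rewrite (quintic_conj cardL) // /y expr_div_n.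
  transitivity (x ^+ q * (x ^+ q ^+ 4 + c * x ^+ 4) * (x / x) * (x ^+ 4 / x ^+ 4)).
    by rewrite !divff ?expf_neq0 ?mulr1.
  transitivity (x ^+ q * x * (x ^+ 4 * (x ^+ q ^+ 4 / x ^+ 4)  + c * (x ^+ 4 / x ^+ 4) * x ^+ 4) / x).
    by ring.
  by rewrite divff ?expf_neq0 //; ring.
have Q0 x : quintic q c x = 0 -> x = 0.
  have [//|x0] := eqVneq x 0.
  rewrite Qy // => /eqP; rewrite mulf_eq0 expf_eq0 (negPf x0).
  by rewrite (negPf (norm1_denom (y1 x x0))).
apply: injF_bij => x x' E.
have [x0|x0] := eqVneq x 0.
  apply/esym; rewrite x0; apply: Q0; rewrite -E x0 /quintic expr0n addn1 exprS.
  by rewrite mul0r mulr0 addr0.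
have [x'0|x'0] := eqVneq x' 0.
  case/eqP: x0; apply: Q0; rewrite E x'0 /quintic expr0n addn1 exprS.
  by rewrite mul0r mulr0 addr0.
have yy : y x = y x'.
  apply: inj; [exact: y1|exact: y1|].
  apply: (mulfI (mulf_neq0 (expf_neq0 5 x0) (expf_neq0 5 x'0))).
  have : quintic q c x ^+ q * quintic q c x' = quintic q c x' ^+ q * quintic q c x.
    by rewrite E.
  by rewrite !Qyq ?Qy // -/c => H; rewrite mulrACA H; ring.
have [u ux] : exists u, x / x' = iota u.
  apply: (iota_fixed iota cardF cardL); rewrite expr_div_n.
  apply: (mulIf (expf_neq0 q x'0)); rewrite divfK ?expf_neq0 //.
  have := yy; rewrite /y => /(canRL (divfK x0)) ->; ring.
have u0 : u != 0 by rewrite -(fmorph_eq0 iota) -ux mulf_neq0 ?invr_neq0.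
suff u1 : u = 1 by move: ux; rewrite u1 rmorph1 => /(canRL (divfK x'0)); rewrite mul1r.
apply: fifth_root_trivial => //; apply: (fmorph_inj iota).
rewrite rmorph1 rmorphXn -ux expr_div_n; apply/eqP.
rewrite (can2_eq (divfK _) (mulfK _)) ?expf_neq0 // mul1r.
move/eqP: E; rewrite !Qy // yy => /eqP E; apply/eqP.
by apply: (mulIf (norm1_denom (y1 x' x'0))).
Qed.

Hypothesis q1mod4 : (q %% 4 = 1)%N.

Lemma sqrt_N1_exists : exists i : F, i ^+ 2 = -1.
Proof.
have q1 := card_sqrt_gt1 cardL.
have N10 : (-1 : F) != 0 by rewrite oppr_eq0 oner_eq0.
have [H|H] := chi_pm1 N10; first by have [i ->] := chi1_sqr H; exists i.
have oF : odd #|F| by rewrite cardF.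
have := expf_half_card oF N10; rewrite H cardF.
have -> : q./2 = (2 * (q %/ 4))%N by lia.
rewrite exprM sqrrN !expr1n => /eqP; rewrite eq_sym -subr_eq0 -opprD oppr_eq0.
by rewrite (negPf two_neq0).
Qed.

(** The hypotheses force e to be r d or - r d, which conjugation negates. *)
Lemma anti_fixed_sqr (d e : L) (r : F) :
  d ^+ q = - d -> e ^+ q = e -> e ^+ 2 = (iota r * d) ^+ 2 -> e = 0.
Proof.
move=> dq eq_ /eqP; rewrite eqf_sqr => /orP[]/eqP E; apply: self_opp_eq0;
  rewrite -[LHS]eq_ {1}E ?(exprN_card cardL) exprMn (iota_expr_card iota cardF) dq mulrN.
  by rewrite -E.
by rewrite opprK [in RHS]E opprK.
Qed.

(** With Y and Z the conjugates, hence inverses, of y and z, dividing the second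
    factor of the numerator by (yz)^2 gives U^2 + b d^2 = 0 for
    U = yZ + zY + b + 3 and d = yz - YZ.  As -b = (i r)^2 this forces U = d = 0;
    then (y^2 - Y^2)^2 = (b+3)^2 - 4 = 4b = (2r)^2, although y^2 - Y^2 is negated
    by conjugation and 2r is not. *)
Lemma norm1_injective_square : b != 0 -> b ^+ 2 + 2%:R * b + 5%:R = 0 -> chi b = 1 ->
  norm1_injective.
Proof.
move=> b0 bE /chi1_sqr[r br] y z y1 z1 E; have [i i2] := sqrt_N1_exists.
set c := iota b in E.
have c0 : c != 0 by rewrite fmorph_eq0.
have cE : c ^+ 2 = - 2%:R * c - 5%:R.
  have /(congr1 iota) := bE; rewrite rmorph0 !rmorphD rmorphM rmorphXn !rmorph_nat.
  by move=> H; rewrite -[LHS]subr0 -H /c; ring.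
have iq := iota_expr_card iota cardF.
have : (y - z) * ((y ^+ 2 + z ^+ 2 + (c + 3%:R) * (y * z)) ^+ 2
          + c * ((y * z) ^+ 2 - 1) ^+ 2) = 0.
  transitivity (y * (y ^+ 4 + c) * (1 + c * z ^+ 4) - z * (z ^+ 4 + c) * (1 + c * y ^+ 4)
     + (c ^+ 2 - (- 2%:R * c - 5%:R)) * ((y - z) * (y * z) * (y ^+ 2 + 2%:R * (y * z) + z ^+ 2))).
    ring.
  by rewrite E cE !subrr mul0r addr0.
move/eqP; rewrite mulf_eq0 subr_eq0 => /orP[/eqP //|/eqP K].
set Y := y ^+ q in y1; set Z := z ^+ q in z1.
have Yq : Y ^+ q = y by apply: expr_card2.
have Zq : Z ^+ q = z by apply: expr_card2.
pose U := y * Z + z * Y + (c + 3%:R); pose d := y * z - Y * Z.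
have Uq : U ^+ q = U.
  have wq : (c + 3%:R) ^+ q = c + 3%:R by rewrite -[3%:R](rmorph_nat iota) -rmorphD iq.
  by rewrite /U (exprD_card cardL (_ + _)) (exprD_card cardL (_ * _)) !exprMn Yq Zq wq -/Y -/Z; ring.
have dq : d ^+ q = - d.
  by rewrite /d (exprD_card cardL) (exprN_card cardL) !exprMn Yq Zq -/Y -/Z; ring.
have {K} K : U ^+ 2 + c * d ^+ 2 = 0.
  transitivity ((Y * Z) ^+ 2 * ((y ^+ 2 + z ^+ 2 + (c + 3%:R) * (y * z)) ^+ 2
          + c * ((y * z) ^+ 2 - 1) ^+ 2)); last by rewrite K mulr0.
  transitivity ((y * Z * (Y * y) + z * Y * (Z * z) + (c + 3%:R) * (Y * y) * (Z * z)) ^+ 2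
      + c * ((Y * y) * (Z * z) * (y * z) - Y * Z) ^+ 2); last by ring.
  by rewrite y1 z1 /U /d; ring.
have U0 : U = 0.
  apply: (anti_fixed_sqr (r := i * r) dq Uq); rewrite exprMn -rmorphXn exprMn i2 -br.
  by rewrite mulN1r rmorphN mulNr; apply/eqP; rewrite -addr_eq0 K.
have d0 : d = 0.
  move: K; rewrite U0 expr0n add0r => /eqP.
  by rewrite mulf_eq0 (negPf c0) expf_eq0 => /eqP.
pose e := y ^+ 2 - Y ^+ 2.
have eq_ : e ^+ q = - e.
  by rewrite /e (exprD_card cardL) (exprN_card cardL) !(exprAC _ 2) Yq -/Y; ring.
have e2 : (iota (2%:R * r)) ^+ 2 = (iota 1 * e) ^+ 2.
  rewrite -rmorphXn exprMn -br rmorphM -/c rmorph1 mul1r.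
  have P1 : (y * z) ^+ 2 = 1.
    transitivity ((y * z) * d + (Y * y) * (Z * z)); first by rewrite /d; ring.
    by rewrite d0 y1 z1 mulr0 mulr1 add0r.
  have A1 : y ^+ 2 + Y ^+ 2 = - (c + 3%:R) * (y * z).
    have ZE : Z = y * (y * z) by rewrite -[LHS]mulr1 -P1 -[RHS]mulr1 -z1; ring.
    have zE : z = Y * (y * z) by rewrite mulrA y1 mul1r.
    transitivity ((y * z) * (y * (y * (y * z)) + (Y * (y * z)) * Y)).
      by transitivity ((y * z) ^+ 2 * (y ^+ 2 + Y ^+ 2)); [rewrite P1 mul1r | ring].
    rewrite -ZE -zE; transitivity ((y * z) * (U - (c + 3%:R))); first by rewrite /U; ring.
    by rewrite U0; ring.
  transitivity ((y ^+ 2 + Y ^+ 2) ^+ 2 - 4%:R * (Y * y) ^+ 2); last by rewrite /e; ring.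
  rewrite A1 y1; transitivity ((c ^+ 2 + 6%:R * c + 9%:R) * (y * z) ^+ 2 - 4%:R); last by ring.
  by rewrite cE P1 -natrX rmorph_nat; ring.
have := anti_fixed_sqr eq_ (iq _) e2 => /eqP.
rewrite fmorph_eq0 mulf_eq0 (negPf two_neq0) /= => /eqP r0.
by case/eqP: b0; rewrite br r0 expr0n.
Qed.

(** The same division yields U^2 + b V^2 = 0 for U = yZ + zY + 3 - b and
    V = yz + YZ, both in F.  As -b is not a
    square, V = 0, so yz is a square root of -1; it lies in F and has norm one,
    whence -1 = (yz)^2 = 1. *)
Lemma norm1_injective_nonsquare : b != 0 -> b ^+ 2 - 2%:R * b + 5%:R = 0 -> chi b = -1 ->
  norm1_injective.
Proof.
move=> b0 bE bN y z y1 z1 E; have [i i2] := sqrt_N1_exists.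
set c := iota b in E.
have cE : c ^+ 2 = 2%:R * c - 5%:R.
  have /(congr1 iota) := bE; rewrite rmorph0 rmorphD rmorphB rmorphXn rmorphM !rmorph_nat.
  by move=> H; rewrite -[LHS]subr0 -H /c; ring.
have iq := iota_expr_card iota cardF.
have : (y - z) * ((y ^+ 2 + z ^+ 2 + (3%:R - c) * (y * z)) ^+ 2
          + c * ((y * z) ^+ 2 + 1) ^+ 2) = 0.
  transitivity (y * (y ^+ 4 + c) * (1 + c * z ^+ 4) - z * (z ^+ 4 + c) * (1 + c * y ^+ 4)
     + (c ^+ 2 - (2%:R * c - 5%:R)) * ((y - z) * (y * z) * (y ^+ 2 + 2%:R * (y * z) + z ^+ 2))).
    ring.
  by rewrite E cE !subrr mul0r addr0.
move/eqP; rewrite mulf_eq0 subr_eq0 => /orP[/eqP //|/eqP K].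
set Y := y ^+ q in y1; set Z := z ^+ q in z1.
have Yq : Y ^+ q = y by apply: expr_card2.
have Zq : Z ^+ q = z by apply: expr_card2.
have [u uE] : exists u, y * Z + z * Y + (3%:R - c) = iota u.
  apply: (iota_fixed iota cardF cardL).
  have wq : (3%:R - c) ^+ q = 3%:R - c by rewrite -[3%:R](rmorph_nat iota) -rmorphB iq.
  by rewrite (exprD_card cardL (_ + _)) (exprD_card cardL (_ * _)) !exprMn Yq Zq wq -/Y -/Z; ring.
have [v vE] : exists v, y * z + Y * Z = iota v.
  apply: (iota_fixed iota cardF cardL).
  by rewrite !(exprD_card cardL) !exprMn Yq Zq -/Y -/Z; ring.
have {K} K : iota (u ^+ 2 + b * v ^+ 2) = 0.
  rewrite rmorphD rmorphM !rmorphXn -uE -vE -/c.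
  transitivity ((Y * Z) ^+ 2 * ((y ^+ 2 + z ^+ 2 + (3%:R - c) * (y * z)) ^+ 2
          + c * ((y * z) ^+ 2 + 1) ^+ 2)); last by rewrite K mulr0.
  transitivity ((y * Z * (Y * y) + z * Y * (Z * z) + (3%:R - c) * (Y * y) * (Z * z)) ^+ 2
      + c * ((Y * y) * (Z * z) * (y * z) + Y * Z) ^+ 2); last by ring.
  by rewrite y1 z1; ring.
move/eqP: K; rewrite fmorph_eq0 => /eqP K.
have v0 : v = 0.
  apply/eqP; apply: contraT => v0.
  have := chiN1_nonsqr (i * (u / v)) bN.
  rewrite exprMn expr_div_n i2 mulN1r => /eqP[].
  apply: (mulIf (expf_neq0 2 v0)); rewrite mulNr divfK ?expf_neq0 //.
  by apply/eqP; rewrite -addr_eq0 addrC K.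
have yz2 : (y * z) ^+ 2 = (iota i) ^+ 2.
  rewrite -rmorphXn i2 rmorphN1; apply/eqP; rewrite -addr_eq0.
  have -> : (y * z) ^+ 2 + 1 = (y * z) * (y * z + Y * Z) + (1 - (Y * y) * (Z * z)) by ring.
  by rewrite vE v0 y1 z1 rmorph0 mulr0 mulr1 subrr addr0.
have yzq : (y * z) ^+ q = y * z.
  have /eqP := yz2; rewrite eqf_sqr => /orP[]/eqP ->; rewrite ?(exprN_card cardL) iq //.
have : (y * z) ^+ 2 = 1.
  by rewrite expr2 -{1}yzq exprMn -/Y -/Z mulrACA y1 z1 mulr1.
rewrite yz2 -rmorphXn i2 rmorphN1 => /esym/self_opp_eq0/eqP.
by rewrite oner_eq0.
Qed.
End Sufficiency.

(** * Integer polynomials as certificates *)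

Fixpoint zpoly_add (s t : seq Z) : seq Z :=
  match s, t with
  | [::], _ => t
  | _, [::] => s
  | x :: s', y :: t' => Z.add x y :: zpoly_add s' t'
  end.

Fixpoint zpoly_mul (s t : seq Z) : seq Z :=
  match s with
  | [::] => [::]
  | x :: s' => zpoly_add (map (Z.mul x) t) (Z0 :: zpoly_mul s' t)
  end.

Section Evaluation.
Variable R : comNzRingType.
Implicit Types (s t : seq Z) (x : R).

Definition zval (z : Z) : R := (int_of_Z z)%:~R.

Lemma zvalD : {morph zval : x y / Z.add x y >-> x + y}.
Proof. by move=> x y; rewrite /zval -rmorphD; congr (_%:~R); lia. Qed.

Lemma zvalM : {morph zval : x y / Z.mul x y >-> x * y}.
Proof. by move=> x y; rewrite /zval -rmorphM; congr (_%:~R); lia. Qed.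

Lemma zvalN : {morph zval : x / Z.opp x >-> - x}.
Proof. by move=> x; rewrite /zval -rmorphN; congr (_%:~R); lia. Qed.

Lemma zval_nat n : zval (Z.of_nat n) = n%:R.
Proof. by rewrite /zval pmulrn; congr (_%:~R); lia. Qed.

Fixpoint zeval s x : R := if s is z :: s' then zval z + x * zeval s' x else 0.

Lemma zeval_add s t x : zeval (zpoly_add s t) x = zeval s x + zeval t x.
Proof.
elim: s t => [|z s IH] [|y t] //=; rewrite ?add0r ?addr0 // IH zvalD; ring.
Qed.

Lemma zeval_scale z t x : zeval (map (Z.mul z) t) x = zval z * zeval t x.
Proof. by elim: t => [|y t IH] /=; rewrite ?mulr0 // IH zvalM; ring. Qed.

Lemma zeval_mul s t x : zeval (zpoly_mul s t) x = zeval s x * zeval t x.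
Proof.
elim: s => [|z s IH] /=; first by rewrite mul0r.
by rewrite zeval_add /= zeval_scale IH [zval Z0]mulr0z; ring.
Qed.

Lemma zeval_cat s t x : zeval (s ++ t) x = zeval s x + x ^+ size s * zeval t x.
Proof. by elim: s => [|z s IH] /=; rewrite ?mul1r ?add0r // IH exprS; ring. Qed.

Lemma zeval_blocks (h : nat -> nat -> Z) m x :
  zeval (flatten [seq [seq h i k | k <- iota 0 4] | i <- iota 0 m]) x
  = \sum_(i < m) \sum_(k < 4) zval (h i k) * x ^+ (4 * i + k).
Proof.
elim: m => [|m IH]; first by rewrite big_ord0.
rewrite -[in iota 0 m.+1]addn1 (iotaD 0 m 1) map_cat flatten_cat zeval_cat IH big_ord_recr /=; congr (_ + _).
have -> : size (flatten [seq [:: h i 0%N; h i 1%N; h i 2; h i 3] | i <- iota 0 m]) = (4 * m)%N.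
  by rewrite -[in RHS](size_iota 0 m); elim: (iota 0 m) => //= i r ->; lia.
by rewrite !big_ord_recl big_ord0 /= /bump /= !exprD; ring.
Qed.

Lemma zeval_multiple (d : Z) s x : zval d = 0 ->
  all (fun z => Z.eqb (Z.modulo z d) Z0) s -> zeval s x = 0.
Proof.
move=> d0; elim: s => //= z s IH /andP[/Z.eqb_eq zd /IH ->].
rewrite mulr0 addr0.
have -> : z = Z.mul d (Z.div z d).
  case: (Z.eq_dec d Z0) => [E|E]; first by move: zd; rewrite E; case: (z).
  by rewrite {1}(Z.div_mod z d E) zd; lia.
by rewrite zvalM d0 mul0r.
Qed.

(** u p1 + v p2 = w modulo d; for d = 0 this is an identity over the integers. *)
Definition bezout_certificate (d : Z) (p1 p2 u v w : seq Z) : bool :=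
  all (fun z => Z.eqb (Z.modulo z d) Z0)
   (zpoly_add (zpoly_add (zpoly_mul u p1) (zpoly_mul v p2)) (map Z.opp w)).

Lemma bezout_common_root (d : Z) (p1 p2 u v w : seq Z) x :
    bezout_certificate d p1 p2 u v w -> zval d = 0 ->
  zeval p1 x = 0 -> zeval p2 x = 0 -> zeval w x = 0.
Proof.
move=> cert d0 e1 e2; have := zeval_multiple x d0 cert.
rewrite !zeval_add !zeval_mul e1 e2 !mulr0 !add0r => H.
suff : zeval (map Z.opp w) x = - zeval w x by rewrite H => /eqP; rewrite eq_sym oppr_eq0 => /eqP.
by elim: w {H cert} => [|z w IH] /=; rewrite ?oppr0 // IH zvalN; ring.
Qed.
End Evaluation.

Definition pascal_step (r : seq Z) : seq Z :=
  [seq Z.add xy.1 xy.2 | xy <- zip r (Z0 :: r)].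
(** The entries C(m, 0), ..., C(m, al) in binary integers, cheap to compute with. *)
Definition pascal_row (al m : nat) : seq Z :=
  iter m pascal_step (Z.of_nat 1 :: nseq al Z0).

Lemma size_pascal_row al m : size (pascal_row al m) = al.+1.
Proof.
elim: m => [|m IH]; first by rewrite /= size_nseq.
by rewrite /pascal_row iterS size_map size_zip /= -/(pascal_row al m) IH; lia.
Qed.

Lemma nth_pascal_row al m j : (j <= al)%N ->
  nth Z0 (pascal_row al m) j = Z.of_nat 'C(m, j).
Proof.
elim: m j => [|m IH] j ja.
  case: j ja => [|j] ja //; rewrite bin0n /= nth_nseq; by case: ifP.
rewrite /pascal_row iterS (nth_map (Z0, Z0)); last first.
  by rewrite size_zip /= -/(pascal_row al m) size_pascal_row; lia.
rewrite nth_zip_cond size_zip /= -/(pascal_row al m) size_pascal_row.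
rewrite (minn_idPl (leqnSn _)) ltnS ja /= IH //.
case: j ja => [|j] ja /=; first by rewrite !bin0.
by rewrite IH ?(ltnW ja) // binS; lia.
Qed.

Definition zbin (m al : nat) : Z := nth Z0 (pascal_row al m) al.

Lemma zbinE m al : zbin m al = Z.of_nat 'C(m, al).
Proof. exact: nth_pascal_row. Qed.

Definition zsign (i : nat) : Z := if odd i then Z.opp (Z.of_nat 1) else Z.of_nat 1.

Lemma zval_sign (R : comNzRingType) i : zval R (zsign i) = (-1) ^+ i.
Proof. by rewrite /zsign -signr_odd; case: odd; rewrite ?zvalN zval_nat ?expr1. Qed.

(** * Power sums for q = 3 mod 4 *)

Section ThreeModFour.
Variables (F L : finFieldType) (iota : {rmorphism F -> L}) (q n : nat).
Hypothesis cardF : #|F| = q.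
Hypothesis cardL : #|L| = (q ^ 2)%N.
Hypothesis qn : q.+1 = (4 * n)%N.
Variable b : F.
Hypothesis b0 : b != 0.
Hypothesis perm : bijective (quintic q (iota b)).

Let s : F := (- b) ^+ n.

(** The power sum with al = 4l - 1, multiplied by (-b)^(5l) and divided by s.
    Its congruence says that n divides j + 5l - i; as 5l <= n the quotient can
    only be 1, 2, 3 or 4. Then b^i (-b)^j (-b)^(5l) = (-1)^i s^(4i) s^(quotient),
    because s^4 = (-b)^(q+1) = b^2. *)
Lemma quintic_power_sum_3mod4 l : (0 < l)%N -> (5 * l <= n)%N ->
  \sum_(i < 4 * l) \sum_(k < 4) ((-1) ^+ i * 'C((4 * l).-1, i)%:R *
      'C(i + k.+1 * n - l.+1, (4 * l).-1)%:R) * s ^+ (4 * i + k) = 0.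
Proof.
move=> l0 ln; have [p pp pF] := finPcharP F.
pose al := (4 * l).-1; pose be := (q - 4 * l)%N.
have al1 : al.+1 = (4 * l)%N by rewrite /al; lia.
have albe : (al + be)%N = q.-1 by rewrite /al /be; lia.
have c0 : - b != 0 by rewrite oppr_eq0.
have s0 : s != 0 by apply: expf_neq0.
have s4 : s ^+ 4 = (- b) ^+ 2.
  rewrite /s -exprM mulnC -qn exprS -[q in _ ^+ q]cardF expf_card; ring.
have inner (i : 'I_al.+1) :
    \sum_(j < be.+1) (b ^+ j *+ 'C(be, j)) *+ (q.+1 %| 5 * al.+1 - 4 * i + 4 * j)
  = \sum_(k < 4) (- b) ^+ (i + k.+1 * n - 5 * l) * 'C(i + k.+1 * n - l.+1, al)%:R.
  have ial : (i < 4 * l)%N by rewrite -al1.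
  transitivity (\sum_(k < 4) \sum_(j < be.+1)
      (b ^+ j *+ 'C(be, j)) *+ (j + 5 * l == i + k.+1 * n)%N).
    rewrite exchange_big /=; apply: eq_bigr => j _; rewrite sumrMnr; congr (_ *+ _).
    have := ltn_ord j; rewrite {2}/be => jbe.
    rewrite !big_ord_recl big_ord0 /= /bump /=.
    have -> : (5 * al.+1 - 4 * i + 4 * j = 4 * (j + 5 * l - i))%N by move: al1 ial; lia.
    rewrite qn dvdn_pmul2l //.
    case: (_ %| _)%N / dvdnP => [[t tE]|H].
      have t5 : (t < 5)%N.
        rewrite ltnNge; apply/negP=> t5; have := leq_mul t5 (leqnn n).
        by rewrite -tE; lia.
      have t0 : (0 < t)%N by rewrite lt0n; apply/eqP=> t0; rewrite t0 in tE; lia.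
      have -> : (j + 5 * l = i + t * n)%N by lia.
      by rewrite !eqn_add2l !eqn_pmul2r; lia.
    have Hk k : (j + 5 * l == i + k * n)%N = false.
      by apply/eqP=> E; apply: H; exists k; lia.
    by rewrite !Hk.
  apply: eq_bigr => k _; rewrite (sum_pred1_shift (fun j => b ^+ j *+ 'C(be, j))).
  have kn : (1 * n <= k.+1 * n <= 4 * n)%N by rewrite !leq_mul2r ltn_ord !orbT.
  set m := (i + _)%N.
  have jE : (i + k.+1 * n - l.+1 = m - 5 * l + al)%N by rewrite /m /al; lia.
  have E : b ^+ (m - 5 * l) *+ 'C(be, m - 5 * l)
      = (- b) ^+ (m - 5 * l) * 'C(i + k.+1 * n - l.+1, al)%:R.
    rewrite -mulr_natr jE; have -> : be = (#|F|.-1 - al)%N by rewrite cardF; lia.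
    rewrite (natr_bin_compl pF) ?cardF; try by rewrite /al /m; lia.
    by rewrite mulrA -exprMn mulrN1.
  rewrite -E; case: ifP => // mN; rewrite bin_small ?mulr0n //.
  by move: mN; rewrite /m; lia.
have := quintic_power_sum_base cardF cardL perm albe.
under eq_bigr => i _ do rewrite inner.
move/(congr1 ( *%R ((- b) ^+ (5 * l)))); rewrite al1 -/al mulr0 => H.
apply: (mulfI s0); rewrite mulr0 -{}[RHS]H !mulr_sumr; apply: eq_bigr => i _.
rewrite !mulr_sumr; apply: eq_bigr => k _.
have kn : (1 * n <= k.+1 * n)%N by rewrite leq_mul2r orbT.
have E1 : (- b) ^+ (5 * l) * (- b) ^+ (i + k.+1 * n - 5 * l) = (- b) ^+ i * s ^+ k.+1.
  rewrite -exprD subnKC; last by lia.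
  by rewrite exprD [(k.+1 * n)%N]mulnC exprM.
have E2 : b ^+ i * (- b) ^+ i = (-1) ^+ i * s ^+ (4 * i).
  by rewrite exprM s4 -!exprMn; congr (_ ^+ _); ring.
rewrite -mulr_natr.
transitivity ((-1) ^+ i * s ^+ (4 * i) * s ^+ k.+1 * 'C(al, i)%:R *
    'C(i + k.+1 * n - l.+1, al)%:R).
  by rewrite exprD exprS; ring.
rewrite -E2.
transitivity (b ^+ i * 'C(al, i)%:R * 'C(i + k.+1 * n - l.+1, al)%:R *
    ((- b) ^+ i * s ^+ k.+1)); first by ring.
by rewrite -E1; ring.
Qed.

End ThreeModFour.

(** * Coefficients of the power sums and their Bezout certificates *)

(** 4^al al! times the coefficient of s^(4i+k) in the power sum, al = 4l - 1:
    the upper entry M = i + (k+1) n - l - 1 of its second binomial satisfies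
    4M = 4i + (k+1) - 4 (l+1) in characteristic p, as 4n = q + 1. *)
Definition generic_coef (l i k : nat) : Z :=
  Z.mul (Z.mul (zsign i) (zbin (4 * l).-1 i))
    (foldr (fun t z => Z.mul (Z.sub (Z.of_nat (4 * i + k.+1)) (Z.of_nat (4 * (l + t.+1)))) z)
       (Z.of_nat 1) (iota 0 (4 * l).-1)).

(** The coefficient of s^(4i+k) in the power sum for q a multiple of p^2,
    l <= p^2/4: only the residues of the upper entries modulo p^2 matter, and
    (3p^2+1)/4 is the residue of n = (q+1)/4. *)
Definition lucas_coef (p l i k : nat) : Z :=
  Z.mul (Z.mul (zsign i) (zbin (4 * l).-1 i))
    (zbin ((i + k.+1 * ((3 * p ^ 2).+1 %/ 4) - l.+1) %% p ^ 2) (4 * l).-1).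

Definition block_poly (h : nat -> nat -> Z) (l : nat) : seq Z :=
  flatten [seq [seq h i k | k <- iota 0 4] | i <- iota 0 (4 * l)].

(** The cofactors below come from the extended Euclidean algorithm over the
    rationals, with denominators cleared. *)
Definition generic_u : seq Z := ([:: -63647114035324854318546956925; -30042198252210899122100860050;
    -16931204307454152583975265445; -8675460056906602708050836520;
    30670785241292299100178196890; 13840814053990556320829784300;
    6555734553937664134861844610; 3019709254985939396110959960;
    4206836872807986998336319585; 2741632907299550770162955970;
    1268895621400634709933911985; 385087844789473065714611760;
    949553043140366757711907260; 896309716263141402862023720;
    552514594412073512523109260; 159216797373710490112619760;
    208054943776588369265993685; 214054058412004704921740370;
    156544713391350697598593485; 45251369358868696937523960;
    68063988268431203752784010; 67249942920714284183787180;
    45007667133646709582240850; 3913414099539674840785080;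
    10708180479697096694707815; 13545192940482725413572030;
    10326888522536281958591175])%coqZ.
Definition generic_v : seq Z := ([:: 27722747222136496718545; 15361910803798231255730;
    7944459275165928605681; 2820883757267803189032; 4234384167648421408082;
    3589177948474563302060; 2109110227888661870266; 265245405778635340200;
    741312807839607477101; 890785862981088003698; 658812664914595340261])%coqZ.
Definition generic_resultant : Z := 14953214882594411088804052992000%coqZ.

(** nseq 4 N is the coefficient list of N (1+X)(1+X^2). *)
Lemma generic_certificate :
  bezout_certificate Z0 (block_poly (generic_coef 1) 1) (block_poly (generic_coef 2) 2)
    generic_u generic_v (nseq 4 generic_resultant).
Proof. by vm_compute. Qed.

(** The cofactors below come from the extended Euclidean algorithm modulo p. *)
Definition lucas_u3 : seq Z := ([:: 1; 0; 1; 2; 0; 0; 2; 1; 0; 2; 2; 2; 1; 2; 2; 1; 2; 2; 0; 2; 2; 1; 0; 0;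
    2; 1; 2])%coqZ.
Definition lucas_v3 : seq Z := ([:: 2; 1; 1; 0; 1; 1; 2; 0; 1; 1; 1])%coqZ.
Lemma lucas_certificate3 :
  bezout_certificate (Z.of_nat 3) (block_poly (lucas_coef 3 1) 1) (block_poly (lucas_coef 3 2) 2)
    lucas_u3 lucas_v3 (nseq 4 1%coqZ).
Proof. by vm_compute. Qed.

Definition lucas_u7 : seq Z := ([:: 1; 0; 6; 0; 4; 6; 1; 5; 0; 1; 2; 3; 5; 6; 0; 0; 0; 5; 4; 3; 4; 5; 5; 3;
    0; 1; 6; 3; 2; 1; 4; 3; 1; 2; 1; 3; 6; 5; 0; 2; 6; 5; 2; 3; 6; 1; 4; 5; 3;
    4; 3; 0; 3; 6; 6; 4; 3; 0; 0; 6; 5; 0; 3; 4; 1; 5; 4; 0; 5; 5; 6; 3; 6; 6])%coqZ.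
Definition lucas_v7 : seq Z := ([:: 1; 4; 2; 5; 4; 1; 2; 6; 1])%coqZ.
(** The common factor picked up here is X (1+X)(1+X^2). *)
Lemma lucas_certificate7 :
  bezout_certificate (Z.of_nat 7) (block_poly (lucas_coef 7 1) 1) (block_poly (lucas_coef 7 5) 5)
    lucas_u7 lucas_v7 (0%coqZ :: nseq 4 1%coqZ).
Proof. by vm_compute. Qed.

Definition lucas_u19 : seq Z := ([:: 14; 2; 7; 17; 6; 11; 1; 9; 16; 9; 11; 0; 14; 17; 7; 11; 15; 15; 3; 7;
    15; 15; 13; 9; 5; 10; 1; 17; 16; 7; 4; 15; 12; 0; 17; 12; 10; 14; 2; 17; 9;
    4; 18; 17; 11; 4; 18; 8; 8; 10; 15; 0; 16; 4; 14; 2; 3; 4; 12; 8; 11; 7; 6;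
    16; 3; 1; 7; 13; 8; 2; 17; 8; 4; 0; 1])%coqZ.
Definition lucas_v19 : seq Z := ([:: 18; 9; 0; 12; 16; 3; 11; 10; 4; 1; 2])%coqZ.
Lemma lucas_certificate19 :
  bezout_certificate (Z.of_nat 19) (block_poly (lucas_coef 19 1) 1) (block_poly (lucas_coef 19 5) 5)
    lucas_u19 lucas_v19 (nseq 4 1%coqZ).
Proof. by vm_compute. Qed.

Definition lucas_u23 : seq Z := ([:: 3; 20; 22; 8; 9; 3; 12; 3; 7; 10; 3; 19; 10; 17; 11; 19; 19; 15; 6; 22;
    6; 12; 12; 21; 9; 14; 11; 17; 1; 14; 18; 15; 12; 8; 18; 1; 6; 15; 9; 12; 9;
    5; 11; 11; 7; 19; 6; 13; 15; 15; 15; 12; 10; 15; 16; 20; 9; 12; 0; 4; 13;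
    16; 20; 18; 11; 18; 14; 11; 17; 12; 4; 4; 3; 8; 17; 7; 16; 7; 6; 13; 5; 8;
    0; 7; 18; 19; 22; 6; 11; 6; 16])%coqZ.
Definition lucas_v23 : seq Z := ([:: 18; 22; 2; 3; 20; 19; 2; 17; 14; 17; 15])%coqZ.
Lemma lucas_certificate23 :
  bezout_certificate (Z.of_nat 23) (block_poly (lucas_coef 23 1) 1) (block_poly (lucas_coef 23 6) 6)
    lucas_u23 lucas_v23 (nseq 4 1%coqZ).
Proof. by vm_compute. Qed.

Definition lucas_u27 : seq Z := ([:: 2; 1; 1; 2; 1; 2; 0; 1; 2; 2; 2; 0; 2; 0; 0; 0; 1; 1; 1; 1; 0; 1; 1; 2;
    2])%coqZ.
Definition lucas_v27 : seq Z := ([:: 1; 2; 2; 1; 2; 2; 0; 0; 1; 1; 0; 0; 2])%coqZ.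
(** For q = 27 only l = 1 satisfies 5l <= n = 7; the second polynomial is
    X^26 - 1, which vanishes at s. *)
Lemma lucas_certificate27 :
  bezout_certificate (Z.of_nat 3) (block_poly (lucas_coef 3 1) 1)
    ((-1)%coqZ :: nseq 25 0%coqZ ++ [:: 1%coqZ])
    lucas_u27 lucas_v27 (nseq 2 1%coqZ).
Proof. by vm_compute. Qed.

Lemma natr_ffact (R : comNzRingType) m al :
  (m ^_ al)%:R = \prod_(t < al) (m%:R - t%:R) :> R.
Proof.
elim: al => [|al IH]; first by rewrite ffactn0 big_ord0.
rewrite ffactnSr natrM big_ord_recr IH /=.
have [ma|ma] := leqP al m; first by rewrite natrB.
by rewrite -IH ffact_small // !mul0r.
Qed.

Lemma zval_foldr_mul (R : comNzRingType) (h : nat -> Z) m :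
  zval R (foldr (fun t z => Z.mul (h t) z) (Z.of_nat 1) (iota 0 m)) = \prod_(t < m) zval R (h t).
Proof.
rewrite -(big_mkord xpredT (fun t => zval R (h t))) /index_iota subn0.
elim: (iota 0 m) => [|t r IH] /=; first by rewrite big_nil (zval_nat R 1).
by rewrite big_cons zvalM IH.
Qed.

(** * Exclusion of q = 3 mod 4 outside 7, 19 and 23 *)

Section NonsquareN1.
Variables (F : finFieldType) (q n : nat).
Hypothesis cardF : #|F| = q.
Hypothesis qn : q.+1 = (4 * n)%N.

(** (q-1)/2 is odd, so x^2 = -1 would give 1 = x^(q-1) = -1. *)
Lemma sqr_neqN1 (x : F) : x ^+ 2 != -1.
Proof.
apply/eqP=> x2; have n0 : (0 < n)%N by lia.
have x0 : x != 0 by apply: contra_eq_neq x2 => ->; rewrite expr0n eq_sym oppr_eq0 oner_eq0.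
have := expf_card_pred x0; rewrite cardF.
have -> : q.-1 = (2 * (2 * n.-1).+1)%N by lia.
rewrite exprM x2 exprS exprM sqrrN !expr1n mulr1 => /eqP.
rewrite eq_sym -addr_eq0 -[1 + 1]/(2%:R) => two.
have := natr_card_finField F; have -> : #|F| = ((2 * n).-1 * 2).+1 by rewrite cardF; lia.
by rewrite -natr1 natrM (eqP two) mulr0 add0r => /eqP; rewrite oner_eq0.
Qed.
End NonsquareN1.

Section ThreeModFour.
Variables (F L : finFieldType) (iota : {rmorphism F -> L}) (q n : nat).
Hypothesis cardF : #|F| = q.
Hypothesis cardL : #|L| = (q ^ 2)%N.
Hypothesis qn : q.+1 = (4 * n)%N.
Variable b : F.
Hypothesis b0 : b != 0.
Hypothesis perm : bijective (quintic q (iota b)).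

Let s : F := (- b) ^+ n.

Lemma generic_vanishing l : (0 < l)%N -> (5 * l <= n)%N ->
  zeval (block_poly (generic_coef l) l) s = 0.
Proof.
move=> l0 ln; have [p pp pF] := finPcharP F.
have n4 : 4%:R * n%:R = 1 :> F.
  by rewrite -natrM -qn -natr1 -cardF natr_card_finField add0r.
rewrite zeval_blocks.
have := quintic_power_sum_3mod4 cardF cardL qn b0 perm l0 ln.
move/(congr1 ( *%R (4%:R ^+ (4 * l).-1 * ((4 * l).-1)`!%:R))).
rewrite mulr0 => H; rewrite -[RHS]H mulr_sumr; apply: eq_bigr => i _.
rewrite mulr_sumr; apply: eq_bigr => k _; rewrite mulrA; congr (_ * _).
rewrite /generic_coef !zvalM zval_sign zbinE zval_nat zval_foldr_mul.
rewrite [RHS]mulrCA; congr (_ * _).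
transitivity (4%:R ^+ (4 * l).-1 * ((i + k.+1 * n - l.+1) ^_ (4 * l).-1)%:R : F); last first.
  by rewrite -bin_ffact natrM; ring.
have -> : 4%:R ^+ (4 * l).-1 = \prod_(t < (4 * l).-1) (4%:R : F).
  by rewrite prodr_const card_ord.
rewrite natr_ffact -big_split /=.
apply: eq_bigr => t _.
have kn : (1 * n <= k.+1 * n)%N by rewrite leq_mul2r orbT.
rewrite zvalD zvalN !zval_nat mulrBr natrB; last by lia.
rewrite -(addSnnS l) (natrD _ (4 * i)) (natrM _ 4 i) (natrM _ 4 (_ + _)).
rewrite (natrD _ l.+1) (natrD _ i) (natrM _ k.+1).
transitivity (4%:R * i%:R + k.+1%:R * (4%:R * n%:R) - 4%:R * (l.+1%:R + t%:R) : F).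
  by rewrite n4 mulr1; ring.
by move: k.+1%:R l.+1%:R => u v; ring.
Qed.

Lemma lucas_vanishing p e l : p \in [pchar F] -> odd p -> q = (p ^ e.+2)%N ->
    (0 < l)%N -> (5 * l <= n)%N -> (4 * l <= p ^ 2)%N -> (l < (3 * p ^ 2).+1 %/ 4)%N ->
  zeval (block_poly (lucas_coef p l) l) s = 0.
Proof.
move=> pF op qp l0 ln alp ln0.
rewrite zeval_blocks -[RHS](quintic_power_sum_3mod4 cardF cardL qn b0 perm l0 ln).
apply: eq_bigr => i _; apply: eq_bigr => k _; congr (_ * _).
rewrite /lucas_coef !zvalM zval_sign !zbinE !zval_nat; congr (_ * _).
apply: (natr_bin_modn pF (r := 2)); first by lia.
set n0 := (_ %/ 4)%N in ln0 *.
have n04 : (4 * n0 = (3 * p ^ 2).+1)%N.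
  have [m pm] : exists m, p = (2 * m).+1 by exists p./2; lia.
  have E : (3 * p ^ 2).+1 = (4 * (3 * (m * m) + 3 * m).+1)%N by rewrite pm -mulnn; nia.
  by rewrite /n0 E mulKn.
have nn0 : n0 = n %[mod p ^ 2].
  (* 4 n0 and 4 n are both 1 modulo p^2; evaluate n0 (4 n) in two ways. *)
  have E1 : (n0 * (4 * n) = n0 * p ^ e * p ^ 2 + n0)%N.
    by rewrite -qn qp -[e.+2]addn2 expnD mulnS mulnA addnC.
  have E2 : (n0 * (4 * n) = n * 3 * p ^ 2 + n)%N.
    by rewrite mulnCA mulnA n04 mulnC mulnS addnC mulnA.
  by rewrite -(modnMDl (n0 * p ^ e)) -E1 E2 modnMDl.
rewrite modn_mod; apply/eqP; rewrite -(eqn_modDr l.+1) !subnK.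
- by rewrite eqn_modDl -modnMmr nn0 modnMmr.
- have kn : (1 * n <= k.+1 * n)%N by rewrite leq_mul2r orbT.
  lia.
have kn : (1 * n0 <= k.+1 * n0)%N by rewrite leq_mul2r orbT.
lia.
Qed.

Hypothesis b2 : b ^+ 2 != 1.

Lemma s_neq0 : s != 0.
Proof. by rewrite expf_neq0 // oppr_eq0. Qed.

(** The value is (1+s)(1+s^2), and s = -1 would give b^2 = s^4 = 1. *)
Lemma one_s_s2_s3_neq0 : 1 + s + s ^+ 2 + s ^+ 3 != 0.
Proof.
have -> : 1 + s + s ^+ 2 + s ^+ 3 = (s + 1) * (s ^+ 2 + 1) by ring.
rewrite mulf_neq0 // ?addr_eq0 ?(sqr_neqN1 cardF qn) //.
apply: contraNneq b2 => sN1; have : s ^+ 4 = 1 by rewrite sN1; ring.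
rewrite /s -exprM mulnC -qn exprS -[q in _ ^+ q]cardF expf_card => <-.
by apply/eqP; ring.
Qed.

Lemma lucas_contradiction p e l u v w :
    p \in [pchar F] -> odd p -> q = (p ^ e.+2)%N ->
    (0 < l)%N -> (5 * l <= n)%N -> (4 * l <= p ^ 2)%N -> (l < (3 * p ^ 2).+1 %/ 4)%N ->
    bezout_certificate (Z.of_nat p) (block_poly (lucas_coef p 1) 1)
      (block_poly (lucas_coef p l) l) u v w ->
  zeval w s = 0.
Proof.
move=> pF op qp l0 ln alp ln0 cert.
apply: (bezout_common_root cert).
- by rewrite zval_nat (pcharf0 pF).
- by apply: (lucas_vanishing pF op qp) => //; lia.
- exact: (lucas_vanishing pF op qp).
Qed.

Lemma zval_smooth_neq0 p (z : Z) (ts : seq nat) : p \in [pchar F] ->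
  all (fun t => 0 < t < p)%N ts -> zval F z != 0 ->
  zval F (foldr (fun t => Z.mul (Z.of_nat t)) z ts) != 0.
Proof.
move=> pF + z0; elim: ts => //= t ts IH /andP[/andP[t0 tp] /IH h].
by rewrite zvalM zval_nat mulf_neq0 // (natr_eq0_pchar pF) gtnNdvd.
Qed.

(** The part of generic_resultant prime to 2, 3, 5, 7, 11, 19, 23 and 31. *)
Definition large_factor : Z := 211914317089%coqZ.

(** large_factor divides r^2 + 1 for the r below, so its prime factors are not
    3 modulo 4. *)
Lemma large_factor_neq0 : zval F large_factor != 0.
Proof.
apply/eqP=> M0; have := sqr_neqN1 cardF qn (zval F 188003278276%coqZ).
case/negP; apply/eqP; rewrite expr2 -zvalM.
have -> : Z.mul 188003278276 188003278276
    = Z.add (Z.mul large_factor 166790206193) (Z.opp (Z.of_nat 1)) by [].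
by rewrite zvalD zvalM M0 mul0r add0r zvalN zval_nat.
Qed.

Lemma generic_resultant_neq0 p : p \in [pchar F] -> (31 < p)%N ->
  zval F generic_resultant != 0.
Proof.
move=> pF p31.
pose ts := nseq 33 2 ++ nseq 2 3 ++ nseq 3 5 ++ nseq 2 7 ++ [:: 11; 19; 23; 31]%N.
have -> : generic_resultant = foldr (fun t => Z.mul (Z.of_nat t)) large_factor ts.
  by vm_compute.
apply: (zval_smooth_neq0 pF) large_factor_neq0.
by rewrite /ts !all_cat !all_nseq /= !(leq_ltn_trans _ p31).
Qed.

(** Write q = p^e; e is odd and p = 3 mod 4, so p is 3, 7, 11, 19, 23, 31 or at
    least 43.  In the last case q >= 39, that is n >= 10, and the equations with
    l = 1 and l = 2 are both available. *)
Lemma quintic_perm_3mod4 : ~~ (5 %| q.-1)%N -> q \in [:: 7; 19; 23]%N.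
Proof.
move=> n5; have [p pp pF] := finPcharP F.
have [e qp] : exists e, q = (p ^ e)%N.
  by exists (logn p q); rewrite -cardF -(card_finField_pchar pF).
have p0 := prime_gt0 pp.
have op : odd p.
  have : odd q by lia.
  by rewrite qp oddX => /orP[/eqP e0|//]; move: qp qn; rewrite e0 => ->; lia.
have p4 : (p %% 4 = 3)%N.
  have [p1|p1] : (p %% 4 = 1 \/ p %% 4 = 3)%N by lia.
    have : (q %% 4 = 1)%N by rewrite qp -modnXm p1 exp1n.
    by lia.
  by [].
have oe : odd e.
  apply: contraT => ee; have : (q %% 4 = 1)%N; last by lia.
  rewrite qp -(odd_double_half e) (negPf ee) add0n -muln2 mulnC expnM.
  by rewrite -modnXm -(modnXm _ _ p) p4 exp1n.
have eS : e <> 1%N -> exists e', q = (p ^ e'.+3)%N.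
  by move=> e1; exists (e - 3)%N; rewrite qp; congr (_ ^ _)%N; lia.
have T := one_s_s2_s3_neq0.
have zevalT c : zeval (nseq 4 c) s = zval F c * (1 + s + s ^+ 2 + s ^+ 3).
  by rewrite /=; ring.
have T1 : zeval (nseq 4 1%coqZ) s != 0 by rewrite zevalT (zval_nat F 1) mul1r.
have [p31|p31] := ltnP 31 p.
  have e0 : (0 < e)%N by move: oe; case: (e).
  have p35 : (35 < p)%N.
    have [//|p35] := ltnP 35 p.
    have p5 : (p == 35)%N by lia.
    by move: pp; rewrite (eqP p5).
  have n10 : (10 <= n)%N by have := leq_pexp2l p0 e0; rewrite -qp expn1; lia.
  have := bezout_common_root generic_certificate (zval_nat F 0)
            (generic_vanishing (ltn0Sn _) _) (generic_vanishing (ltn0Sn _) _).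
  move/(_ (leq_trans _ n10) n10); rewrite zevalT => /(_ isT)/eqP.
  by rewrite mulf_eq0 (negPf T) (negPf (generic_resultant_neq0 pF p31)).
have : p \in [:: 3; 7; 11; 19; 23; 31]%N.
  have : [|| p == 3, p == 7, p == 11, p == 15, p == 19, p == 23, p == 27 | p == 31]%N.
    by lia.
  by move: pp; do ?[case: eqP => [->|_] //=].
have base5 : (p %% 5 = 1)%N -> False.
  move=> p1; case/negP: n5; rewrite -subn1 -eqn_mod_dvd ?qp ?expn_gt0 ?p0 //.
    by rewrite -modnXm p1 exp1n.
rewrite !inE; case: (eqVneq e 1%N) => [e1|/eqP/eS[e' qe]].
  case/or4P=> [/eqP pE|/eqP pE|/eqP pE|/or3P[/eqP pE|/eqP pE|/eqP pE]].
  - case/eqP: b2; apply: (mulfI b0); rewrite -exprS mulr1.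
    by have := expf_card b; rewrite cardF qp e1 pE.
  - by rewrite qp e1 pE.
  - by case: base5; rewrite pE.
  - by rewrite qp e1 pE.
  - by rewrite qp e1 pE.
  - by case: base5; rewrite pE.
have n3 : (p ^ 3 <= 4 * n)%N by rewrite -qn qe (leq_trans _ (leqnSn _)) // leq_pexp2l.
case/or4P=> [/eqP pE|/eqP pE|/eqP pE|/or3P[/eqP pE|/eqP pE|/eqP pE]];
  rewrite pE in pF op qe n3 base5; try by case: base5.
- have [e0|e'0] := posnP e'.
    have s26 : zeval ((-1)%coqZ :: nseq 25 0%coqZ ++ [:: 1%coqZ]) s = 0.
      rewrite /= (zval_nat F 0) (zval_nat F 1) mulr0 !add0r addr0 mulr1.
      rewrite -expr2 -!exprS (zvalN F (Z.of_nat 1)) zval_nat.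
      by have := expf_card_pred s_neq0; rewrite cardF qe e0 => /= ->; rewrite addNr.
    have n7 : n = 7%N by have := qn; rewrite qe e0; lia.
    have s1 : zeval (nseq 2 1%coqZ) s = 0.
      apply: (bezout_common_root lucas_certificate27 _ _ s26).
        by rewrite (zval_nat F 3) (pcharf0 pF).
      by apply: (lucas_vanishing pF op qe); rewrite // n7.
    case/negP: T1; rewrite zevalT; move: s1; rewrite /= (zval_nat F 1) => s1.
    by apply/eqP; transitivity ((1 + s * (1 + s * 0)) * (1 + s ^+ 2)); [ring | rewrite s1 mul0r].
  case/negP: T1; apply/eqP; apply: (lucas_contradiction pF op qe _ _ _ _ lucas_certificate3) => //.
  have := leq_pexp2l (isT : 0 < 3)%N (_ : 4 <= e'.+3)%N.
  by move/(_ e'0); rewrite -qe; lia.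
- have /eqP : zeval (0%coqZ :: nseq 4 1%coqZ) s = 0.
    apply: (lucas_contradiction pF op qe _ _ _ _ lucas_certificate7) => //.
    by move: n3; rewrite -[(7 ^ 3)%N]/(7 * 7 * 7)%N; lia.
  by rewrite [zeval _ _]/= (zval_nat F 0) add0r mulf_eq0 (negPf s_neq0) (negPf T1).
- case/negP: T1; apply/eqP; apply: (lucas_contradiction pF op qe _ _ _ _ lucas_certificate19) => //.
  by move: n3; rewrite -[(19 ^ 3)%N]/(19 * 19 * 19)%N; lia.
- case/negP: T1; apply/eqP; apply: (lucas_contradiction pF op qe _ _ _ _ lucas_certificate23) => //.
  by move: n3; rewrite -[(23 ^ 3)%N]/(23 * 23 * 23)%N; lia.
Qed.

End ThreeModFour.

(** * The prime fields of order 7, 19 and 23 *)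

(** The map Q on u + iv, for i^2 = -1 and conjugate u - iv, with reduced
    coordinates. *)
Definition gauss_quintic (q : nat) (m : Z) (w : Z * Z) : Z * Z :=
  let: (u, v) := w in
  let p := Z.sub (Z.mul u u) (Z.mul v v) in
  let r := Z.mul 2 (Z.mul u v) in
  let P := Z.mul (Z.add 1 m) (Z.sub (Z.mul p p) (Z.mul r r)) in
  let S := Z.mul (Z.sub 1 m) (Z.mul 2 (Z.mul p r)) in
  (Z.modulo (Z.sub (Z.mul u P) (Z.mul v S)) (Z.of_nat q),
   Z.modulo (Z.add (Z.mul u S) (Z.mul v P)) (Z.of_nat q)).

Definition residue_grid (q : nat) : seq (Z * Z) :=
  [seq (Z.of_nat u, Z.of_nat v) | u <- iota 0 q, v <- iota 0 q].

Lemma gauss_quintic_table :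
  all (fun q => all (fun m => (m \in [:: 0; 1; q.-1]%N) ||
      (uniq (map (gauss_quintic q (Z.of_nat m)) (residue_grid q))
        == ((q, m) \in exceptional_pairs)))
    (iota 0 q)) [:: 7; 19; 23]%N.
Proof. by vm_compute. Qed.

Section PrimeField.
Variables (F : finFieldType) (q : nat).
Hypothesis cardF : #|F| = q.
Hypothesis q_prime : prime q.

Lemma pchar_prime_card : q \in [pchar F].
Proof. by apply: (@card_finPcharP F q 1); rewrite ?expn1. Qed.

Lemma prime_field_natr_inj i j : (i < q)%N -> (j < q)%N -> i%:R = j%:R :> F -> i = j.
Proof.
wlog ij : i j / (i <= j)%N.
  by move=> W; case: (leqP i j) => [|/ltnW] ij iq jq E; [|symmetry]; apply: W.
move=> iq jq E; have : (j - i)%:R == 0 :> F by rewrite natrB // E subrr.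
rewrite (natr_eq0_pchar pchar_prime_card) /dvdn modn_small; lia.
Qed.

Lemma prime_field_natr (x : F) : exists2 m, (m < q)%N & x = m%:R.
Proof.
have inj : injective (fun i : 'I_q => (i%:R : F)).
  by move=> i j /(prime_field_natr_inj (ltn_ord i) (ltn_ord j))/val_inj.
have /codomP[i ->] : x \in codom (fun i : 'I_q => (i%:R : F)).
  by apply: (inj_card_onto inj); rewrite card_ord cardF leqnn.
by exists i.
Qed.

Variables (L : finFieldType) (iota : {rmorphism F -> L}) (n : nat).
Hypothesis cardL : #|L| = (q ^ 2)%N.
Hypothesis qn : q.+1 = (4 * n)%N.

Lemma ext_sqrt_N1 : exists i : L, i ^+ 2 = -1 /\ i ^+ q = - i.
Proof.
have N10 : (-1 : L) != 0 by rewrite oppr_eq0 oner_eq0.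
have oL : odd #|L| by rewrite cardL oddX /=; lia.
have qo : odd q by lia.
have [i i2] : exists i : L, i ^+ 2 = -1.
  have [H|H] := chi_pm1 N10; first by have [i ->] := chi1_sqr H; exists i.
  have := expf_half_card oL N10; rewrite H.
  have -> : #|L|./2 = (2 * (n * (2 * n).-1 * 2))%N.
    have E : (q * q = (2 * (n * (2 * n).-1 * 2)).*2.+1)%N.
      have [m nm] : exists m, n = m.+1 by exists n.-1; lia.
      have qm : q = (4 * m + 3)%N by lia.
      have -> : (2 * n).-1 = (2 * m).+1 by lia.
      by rewrite qm nm; nia.
    by rewrite cardL -mulnn E /= uphalf_double.
  rewrite exprM sqrrN !expr1n => /eqP; rewrite eq_sym -subr_eq0 -opprD oppr_eq0.
  by rewrite (negPf (twoL_neq0 iota cardF cardL qo)).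
exists i; split=> //; have -> : q = (2 * (2 * n.-1).+1).+1 by lia.
by rewrite exprS exprM i2 exprS exprM sqrrN !expr1n mulr1 mulrN1.
Qed.

(** As q = 3 mod 4, the extension is F(i) and its elements are the u + iv with
    0 <= u, v < q, each written once. *)
Lemma quintic_bij_uniq (m : nat) :
  bijective (quintic q (iota m%:R))
  <-> uniq (map (gauss_quintic q (Z.of_nat m)) (residue_grid q)).
Proof.
have [i [i2 iq]] := ext_sqrt_N1; have q0 := prime_gt0 q_prime.
pose pt (w : Z * Z) : L := iota (zval F w.1) + iota (zval F w.2) * i.
have iotaq := iota_expr_card iota cardF.
have zq : zval F (Z.of_nat q) = 0 by rewrite zval_nat (pcharf0 pchar_prime_card).
have zmod z : zval F (Z.modulo z (Z.of_nat q)) = zval F z.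
  have -> : Z.modulo z (Z.of_nat q) = Z.add z (Z.opp (Z.mul (Z.of_nat q) (Z.div z (Z.of_nat q)))).
    by have := Z.div_mod z (Z.of_nat q); lia.
  by rewrite zvalD zvalN zvalM zq mul0r oppr0 addr0.
have zvalB x y : zval F (Z.sub x y) = zval F x - zval F y.
  by rewrite -Z.add_opp_r zvalD zvalN.
have ptG w : quintic q (iota m%:R) (pt w) = pt (gauss_quintic q (Z.of_nat m) w).
  case: w => u v; rewrite /gauss_quintic (quinticE q) /pt; cbv beta iota zeta delta [fst snd]; rewrite !zmod.
  rewrite (exprD_card cardL) exprMn iq !iotaq.
  rewrite !(zvalB, zvalD, zvalM) zval_nat.
  rewrite -[zval F 1%coqZ]/(zval F (Z.of_nat 1)) -[zval F 2%coqZ]/(zval F (Z.of_nat 2)) !zval_nat.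
  rewrite !(rmorphB, rmorphN, rmorphD, rmorphM) !rmorph_nat ?rmorph1.
  move: (iota (zval F u)) (iota (zval F v)) => U V; rewrite mulrN -mulNr.
  have sq x y : (x + y * i) ^+ 2 = x ^+ 2 - y ^+ 2 + 2%:R * (x * y) * i.
    by transitivity (x ^+ 2 + y ^+ 2 * i ^+ 2 + 2%:R * (x * y) * i); [ring | rewrite i2; ring].
  have ml x y x' y' : (x + y * i) * (x' + y' * i) = x * x' - y * y' + (x * y' + y * x') * i.
    transitivity (x * x' + y * y' * i ^+ 2 + (x * y' + y * x') * i); first by ring.
    by rewrite i2; ring.
  rewrite !(exprM _ 2 2) !sq.
  rewrite mulrDr [_ * (m%:R * _)]mulrCA !ml; ring.
have pt_inj : {in residue_grid q &, injective pt}.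
  move=> w w' /allpairsP[[u v] /= [uq vq ->]] /allpairsP[[u' v'] /= [uq' vq' ->]].
  rewrite /pt /= !zval_nat => E.
  have [vv|vv] := eqVneq (v%:R : F) v'%:R.
    move: E; rewrite vv => /addIr/fmorph_inj/(prime_field_natr_inj _ _) uu'.
    rewrite !mem_iota in uq vq uq' vq'.
    by rewrite uu' // (prime_field_natr_inj _ _ vv).
  have := sqr_neqN1 cardF qn ((u%:R - u'%:R) / (v'%:R - v%:R)); case/eqP.
  have vv' : v'%:R - v%:R != 0 :> F by rewrite subr_eq0 eq_sym.
  apply: (fmorph_inj iota); rewrite rmorphXn rmorphN1 -i2; congr (_ ^+ _).
  have vL : iota v'%:R - iota v%:R != 0 by rewrite -rmorphB fmorph_eq0.
  rewrite fmorph_div !rmorphB; apply/eqP; rewrite (can2_eq (divfK vL) (mulfK vL)).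
  have E' : iota u%:R = iota u'%:R + iota v'%:R * i - iota v%:R * i by rewrite -E addrK.
  by rewrite subr_eq; apply/eqP; rewrite E'; ring.
have G_grid w : gauss_quintic q (Z.of_nat m) w \in residue_grid q.
  have md z : exists2 u, u \in seq.iota 0 q & Z.modulo z (Z.of_nat q) = Z.of_nat u.
    by exists (Z.to_nat (Z.modulo z (Z.of_nat q))); rewrite ?mem_iota;
      have := Z.mod_pos_bound z (Z.of_nat q); lia.
  case: w => u v; rewrite /gauss_quintic.
  set x := Z.modulo _ _; set y := Z.modulo _ _.
  have [u' uq ->] : exists2 u, u \in seq.iota 0 q & x = Z.of_nat u by apply: md.
  have [v' vq ->] : exists2 u, u \in seq.iota 0 q & y = Z.of_nat u by apply: md.
  by apply/allpairsP; exists (u', v').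
have sz : size (map pt (residue_grid q)) = #|L|.
  by rewrite size_map size_allpairs !size_iota cardL mulnn.
have un : uniq (map pt (residue_grid q)).
  rewrite map_inj_in_uniq // allpairs_uniq ?iota_uniq //.
  by move=> [u v] [u' v'] _ _ /= [/Nat2Z.inj -> /Nat2Z.inj ->].
have pe : perm_eq (map pt (residue_grid q)) (enum L).
  have sub : {subset map pt (residue_grid q) <= enum L} by move=> x _; rewrite mem_enum.
  have [_ eqm] := uniq_min_size un sub (eq_leq (etrans (esym (cardE L)) (esym sz))).
  by apply: uniq_perm; rewrite ?enum_uniq.
have step : uniq (map (gauss_quintic q (Z.of_nat m)) (residue_grid q))
    = injectiveb (quintic q (iota m%:R)).
  rewrite /injectiveb /dinjectiveb -(perm_uniq (perm_map _ pe)).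
  have -> : map (quintic q (iota m%:R)) (map pt (residue_grid q))
      = map pt (map (gauss_quintic q (Z.of_nat m)) (residue_grid q)).
    by rewrite -!map_comp; apply: eq_map => w /=.
  rewrite [RHS]map_inj_in_uniq // => w w' /mapP[x _ ->] /mapP[x' _ ->].
  by apply: pt_inj.
rewrite step; split=> [/bij_inj/injectiveP //|/injectiveP inj].
exact: injF_bij.
Qed.

End PrimeField.

(** * The classification *)

Lemma exceptional_pairs_range : all (fun qm => [&& qm.1 \in [:: 7; 19; 23], qm.2 < qm.1
    & qm.2 \notin [:: 0; 1; qm.1.-1]])%N exceptional_pairs.
Proof. by vm_compute. Qed.

Lemma prime_quintic_perm (F L : finFieldType) (iota : {rmorphism F -> L}) q m :
    #|F| = q -> #|L| = (q ^ 2)%N -> q \in [:: 7; 19; 23]%N ->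
    (m < q)%N -> m \notin [:: 0; 1; q.-1]%N ->
  bijective (quintic q (iota m%:R)) <-> (q, m) \in exceptional_pairs.
Proof.
move=> cardF cardL qin mq mnin.
have := allP (allP gauss_quintic_table q qin) m.
rewrite mem_iota add0n mq (negPf mnin) => /(_ isT)/eqP <-.
have [n qn] : exists n, q.+1 = (4 * n)%N.
  by move: qin; rewrite !inE => /or3P[]/eqP ->; [exists 2 | exists 5 | exists 6].
have qp : prime q by move: qin; rewrite !inE => /or3P[]/eqP ->.
exact: (quintic_bij_uniq cardF qp iota cardL qn).
Qed.

(* The embedding iota presents L as a copy of F_(q^2) containing F = F_q. *)
Theorem theorem1p1 (q : nat) (F L : finFieldType) (iota : {rmorphism F -> L})
    (q_odd : odd q) (cardF : #|F| = q) (cardL : #|L| = (q ^ 2)%N)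
    (a b : F) (b_neq0 : b <> 0) (b_neq1 : b <> 1) (b_neqN1 : b <> -1)
    (a_neqb : a <> b) (a_neqNb : a <> - b) :
  permutation_poly (map_poly iota (Fab q a b)) <->
  ([/\ q = 1 %[mod 4],
       q <> 1 %[mod 5] &
       (b ^+ 2 + 2%:R * b + 5%:R = 0 /\ chi b = 1) \/
       (b ^+ 2 - 2%:R * b + 5%:R = 0 /\ chi b = -1)]
   \/ (exists2 m : nat, (q, m) \in exceptional_pairs & b = m%:R)).
Proof.
have b0 : b != 0 by apply/eqP.
have b2 : b ^+ 2 != 1 by rewrite sqrf_eq1 negb_or; apply/andP; split; apply/eqP.
have ab : a ^+ 2 != b ^+ 2 by rewrite eqf_sqr negb_or; apply/andP; split; apply/eqP.
have q1 := card_sqrt_gt1 cardL.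
have mod5 : (q <> 1 %[mod 5]) <-> ~~ (5 %| q.-1)%N.
  by rewrite -subn1 -eqn_mod_dvd ?(ltnW q1) //; split=> /eqP.
apply: (iff_trans (Fab_perm_quintic iota cardF cardL b0 ab)); split=> [bij|[[q4 q5 bE]|]].
- have n5 := quintic_perm_mod5 cardF cardL bij.
  have [q4|q4] : (q %% 4 = 1 \/ q %% 4 = 3)%N by lia.
    left; split; [by rewrite q4 | exact/mod5 |].
    have qk : q = (4 * (q %/ 4) + 1)%N by lia.
    have := quintic_perm_1mod4 cardF cardL bij qk b0.
    have -> : b ^+ (2 * (q %/ 4)) = (chi b)%:~R.
      by rewrite -expf_half_card ?cardF //; congr (_ ^+ _); lia.
    have [->|->] := chi_pm1 b0 => /eqP; rewrite mulf_eq0 subr_eq0.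
      by rewrite mulr1 => /orP[/eqP //|/eqP H]; left.
    rewrite rmorphN1 mulrN1 eqr_oppLR sqrrN mulrN => /orP[/eqP //|/eqP H].
    by right.
  have [n qn] : exists n, q.+1 = (4 * n)%N by exists (q.+1 %/ 4)%N; lia.
  have qin := quintic_perm_3mod4 cardF cardL qn b0 bij b2 n5.
  have qp : prime q by move: qin; rewrite !inE => /or3P[]/eqP ->.
  have [m mq bm] := prime_field_natr cardF qp b.
  right; exists m => //; rewrite bm in bij b_neq0 b_neq1 b_neqN1.
  apply/(prime_quintic_perm iota cardF cardL qin mq) => //.
  rewrite !inE; apply/negP=> /or3P[]/eqP mE; [by case: b_neq0; rewrite mE | by case: b_neq1; rewrite mE |].
  case: b_neqN1; apply/eqP; rewrite -addr_eq0 natr1 mE prednK ?(ltnW q1) //.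
  by rewrite -cardF natr_card_finField.
- have q4' : (q %% 4 = 1)%N by rewrite q4.
  apply: (norm1_injective_bij cardF cardL b2); first exact/mod5.
  case: bE => [[bE bc]|[bE bc]].
    exact: (norm1_injective_square cardF cardL).
  exact: (norm1_injective_nonsquare cardF cardL).
case=> m em bm; rewrite bm.
have /and3P[qin mq mnin] := allP exceptional_pairs_range _ em.
exact/(prime_quintic_perm iota cardF cardL qin mq).
Qed.
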